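(* Let $A,M,S$ be positive integers with $M\ge S^2$ and $M$ even, and let $L=M/2$. Let $\alpha,\beta>0$ and let $\Omega=\{\omega_j\}_{j=1}^S\subset\mathbb{T}$ satisfy the clumps model with a minimum separation with parameters $(A,L,S,\beta,\alpha)$, with clump cardinalities $\lambda_1,\dots,\lambda_A$, where $$\beta\ge\max_{1\le a\le A}\frac{20\,S^{1/2}\lambda_a^{5/2}}{\alpha^{1/2}}.$$ For $1\le a\le A$ let $c_a=C_a(\lambda_a,L)$. Let $x\in\mathbb{C}^S$, $\eta\in\mathbb{C}^{M+1}$, $y=\Phi(\Omega,M)x+\eta$ and $x_{\min}=\min_j|x_j|$. If $$4\|\mathcal{H}(\eta)\|_2\sum_{a=1}^A\big(c_a\alpha^{-\lambda_a+1}\big)^2<x_{\min}M,$$ then $$\sup_{\omega\in[0,1)}|\hat{\mathcal{R}}(\omega)-\mathcal{R}(\omega)|\le\frac{4\sqrt L\,\|\eta\|_2}{x_{\min}M}\sum_{a=1}^A\big(c_a\,\alpha^{-\lambda_a+1}\big)^2 .$$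
   Context: $\mathbb{T}=[0,1)$ is the periodic unit interval, $|\omega|_{\mathbb{T}}:=\min_{n\in\mathbb{Z}}|\omega-n|$. $\Phi(\Omega,M)$ is the $(M+1)\times S$ matrix with entries $e^{-2\pi i m\omega_j}$, $0\le m\le M$, $1\le j\le S$. Clumps model with a minimum separation with parameters $(A,L,S,\beta,\alpha)$: (1) $\Omega$ has cardinality $S$ and is a disjoint union $\Omega=\bigcup_{a=1}^A\Lambda_a$ of nonempty finite sets, each $\Lambda_a$ contained in an open interval (arc) of length $1/L$; (2) if $A>1$, then $|\omega-\omega'|_{\mathbb{T}}\ge\beta/L$ whenever $\omega,\omega'$ belong to different $\Lambda_a$'s; (3) $\min_{j\ne k}|\omega_j-\omega_k|_{\mathbb{T}}\ge\alpha/L$ and $\max_a(\lambda_a-1)<1/\alpha$, where $\lambda_a=|\Lambda_a|$. Constants: for a positive integer $\lambda$ and an integer $L\ge\lambda$, $$B(\lambda,L):=\tfrac{20\sqrt2}{19}\Big(1-\tfrac{\pi^2}{3\lambda^2}\Big)^{-(\lambda-1)/2}\Big(\tfrac{L}{\lambda}\Big)^{\lambda-1}\Big\lfloor\tfrac{L}{\lambda}\Big\rfloor^{-(\lambda-1)},$$ $$C_a(\lambda,L):=B(\lambda,L)\,\lambda\Big(\tfrac{\lambda}{\pi}\Big)^{\lambda-1}\Big(\sum_{j=1}^{\lambda}\prod_{k=1,k\ne j}^{\lambda}\tfrac{1}{(j-k)^2}\Big)^{1/2}$$ (powers with exponent $0$ and empty products equal $1$). MUSIC notation: for $z=(z_0,\dots,z_M)\in\mathbb{C}^{M+1}$,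 $\mathcal{H}(z)\in\mathbb{C}^{(L+1)\times(M-L+1)}$ is the Hankel matrix with entries $\mathcal{H}(z)_{p,q}=z_{p+q}$, $0\le p\le L$, $0\le q\le M-L$; $\|\cdot\|_2$ is the spectral norm for matrices and the Euclidean norm for vectors. With $y^0=\Phi(\Omega,M)x$, the matrix $\mathcal{H}(y^0)$ has rank $S$ when all $x_j\ne0$; $W$ is a matrix whose columns form an orthonormal basis of $\mathrm{Range}(\mathcal{H}(y^0))^\perp$ in $\mathbb{C}^{L+1}$. $\hat W$ is the matrix whose $L+1-S$ columns are the left singular vectors in a (full) singular value decomposition of $\mathcal{H}(y)$, with singular values in decreasing order, other than the first $S$ left singular vectors. With $\phi_L(\omega)=(1,e^{-2\pi i\omega},\dots,e^{-2\pi iL\omega})^T\in\mathbb{C}^{L+1}$, the noise-space correlation functions are $$\mathcal{R}(\omega)=\frac{\|W^*\phi_L(\omega)\|_2}{\|\phi_L(\omega)\|_2},\qquad \hat{\mathcal{R}}(\omega)=\frac{\|\hat W^*\phi_L(\omega)\|_2}{\|\phi_L(\omega)\|_2}.$$ *)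

(* Defs.v *)
From mathcomp Require Import all_boot all_order all_algebra.
From mathcomp Require Import spectral sesquilinear.
From mathcomp Require Import classical_sets reals constructive_ereal ereal exp trigo.
From mathcomp.real_closed Require Import complex.

Set Implicit Arguments.
Unset Strict Implicit.
Unset Printing Implicit Defensive.

Import Order.TTheory GRing.Theory Num.Theory.
Import ComplexField.Normc.

Local Open Scope ring_scope.
Local Open Scope complex_scope.
Local Open Scope sesquilinear_scope.

(* Points of the torus are represented by reals in [0, 1). *)

(* The infimum is a minimum: it is attained at one of the two integers
   closest to w. *)
Definition Tnorm (R : realType) (w : R) : R :=
  inf [set `|w - n%:~R| | n in [set: int]]%classic.

(* The arc (t, t + len) of the torus. *)
Definition in_open_arc (R : realType) (t len w : R) : Prop :=
  exists n : int, t < w + n%:~R < t + len.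

(* Omega is enumerated by the injection omega, and its subset Lambda_a is
   given by the set Lambda a of the indices of its points. *)
Record clumps_model (R : realType) (A L S : nat) (beta alpha : R)
    (omega : 'I_S -> R) (Lambda : 'I_A -> {set 'I_S}) : Prop := ClumpsModel {
  clumps_torus : forall j, 0 <= omega j < 1;
  clumps_inj : injective omega;
  clumps_cover : forall j, exists a, j \in Lambda a;
  clumps_disjoint : forall a b, a != b -> [disjoint Lambda a & Lambda b];
  clumps_nonempty : forall a, Lambda a != finset.set0;
  clumps_arc : forall a, exists t : R,
    forall j, j \in Lambda a -> in_open_arc t (L%:R^-1) (omega j);
  clumps_sep : (1 < A)%N -> forall a b j k, a != b ->
    j \in Lambda a -> k \in Lambda b -> beta / L%:R <= Tnorm (omega j - omega k);
  clumps_min_sep : forall j k, j != k ->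
    alpha / L%:R <= Tnorm (omega j - omega k);
  clumps_card : forall a, (#|Lambda a|%:R - 1 : R) < alpha^-1
}.

(* For lambda = 1 the base 1 - pi^2 / 3 is negative; powR with exponent 0 is 1. *)
Definition B_const (R : realType) (lambda L : nat) : R :=
  (20 * Num.sqrt 2 / 19)
  * powR (1 - pi ^+ 2 / (3 * lambda%:R ^+ 2)) (- (lambda%:R - 1) / 2)
  * (L%:R / lambda%:R) ^+ (lambda - 1)
  * (L %/ lambda)%N%:R ^- (lambda - 1).

Definition C_const (R : realType) (lambda L : nat) : R :=
  B_const R lambda L * lambda%:R * (lambda%:R / pi) ^+ (lambda - 1)
  * Num.sqrt (\sum_(1 <= j < lambda.+1)
      \prod_(1 <= k < lambda.+1 | k != j) (1 / (j%:R - k%:R) ^+ 2)).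

Definition expi (R : realType) (t : R) : R[i] := cos t +i* sin t.

Definition Phi (R : realType) (S M : nat) (omega : 'I_S -> R) :
    'M[R[i]]_(M.+1, S) :=
  \matrix_(m < M.+1, j < S) expi (- (2 * pi * m%:R * omega j)).

Definition phi (R : realType) (L : nat) (w : R) : 'cV[R[i]]_L.+1 :=
  \col_(m < L.+1) expi (- (2 * pi * m%:R * w)).

(* For L <= M the index p + q is at most M, so inord never truncates. *)
Definition hankel (R : realType) (M L : nat) (z : 'cV[R[i]]_M.+1) :
    'M[R[i]]_(L.+1, (M - L).+1) :=
  \matrix_(p < L.+1, q < (M - L).+1) z (inord (p + q)) 0.

Definition l2norm (R : realType) (n : nat) (v : 'cV[R[i]]_n) : R :=
  Num.sqrt (\sum_i normc (v i 0) ^+ 2).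

Definition spectral_norm (R : realType) (m n : nat) (A : 'M[R[i]]_(m, n)) : R :=
  sup [set l2norm (A *m v) | v in [set v | l2norm v <= 1]]%classic.

(* For n > 0 the infimum is the minimum of finitely many values. *)
Definition min_modulus (R : realType) (n : nat) (x : 'cV[R[i]]_n) : R :=
  inf [set normc (x j 0) | j in [set: 'I_n]]%classic.

Definition orthonormal_basis_range_perp (R : realType) (m n k : nat)
    (H : 'M[R[i]]_(m, n)) (W : 'M[R[i]]_(m, k)) : Prop :=
  W ^t* *m W = 1%:M /\
  (forall v : 'cV[R[i]]_m,
     (forall u : 'cV[R[i]]_n, (H *m u) ^t* *m v = 0) <->
     (exists c : 'cV[R[i]]_k, v = W *m c)).

(* Full singular value decomposition; the singular values are
   s 0 >= s 1 >= ..., only those of index < minn m n occurring in H. *)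
Definition is_svd (R : realType) (m n : nat) (H : 'M[R[i]]_(m, n))
    (U : 'M[R[i]]_m) (s : nat -> R) (V : 'M[R[i]]_n) : Prop :=
  [/\ U \is unitarymx, V \is unitarymx,
      (forall i, 0 <= s i), (forall i j, (i <= j)%N -> s j <= s i) &
      H = U *m (\matrix_(i < m, j < n) (if i == j :> nat then (s i)%:C else 0))
            *m V ^t*].

(* What : the last L + 1 - S columns of U, where S <= L + 1. *)
Definition last_columns (R : realType) (L S : nat) (U : 'M[R[i]]_L.+1) :
    'M[R[i]]_(L.+1, L.+1 - S) :=
  \matrix_(i < L.+1, j < L.+1 - S) U i (inord (S + j)).

Definition noise_correlation (R : realType) (L k : nat)
    (W : 'M[R[i]]_(L.+1, k)) (w : R) : R :=
  l2norm (W ^t* *m phi L w) / l2norm (phi L w).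

(* Main.v *)
(* Write H(y0) = Phi_L diag(x) Phi_L^T, so that the smallest singular value of
   H(y0) on its row space is at least min |x_j| sigma_min(Phi_L)^2.  By Weyl's
   inequalities the S-th and (S+1)-st singular values of H(y) are then separated
   by the noise, and the noise spaces of H(y0) and H(y) differ by at most
   2 |H(eta)| / sigma_S(H(y0)) in norm.

   The lower bound (L+1) / sum_a (c_a alpha^(1-lambda_a))^2 for sigma_min(Phi_L)^2
   (with L+1 in place of L: the surplus pays for |H(eta)| <= sqrt(L+1) |eta|)
   is obtained by duality, from trigonometric polynomials of degree L that
   interpolate 1 at omega_j, vanish at the rest of its clump and are tiny at the
   other clumps.  Each is the product of a Lagrange polynomial at frequency
   Q = floor(L / lambda), whose nodes stay within a fraction 1/lambda of a period,
   and of the power 2 lambda of a normalised Dirichlet kernel of degree about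
   L / (2 lambda^2), whose decay beats the size of the Lagrange factor.
   If alpha > 1 all clumps are singletons, possibly separated by alpha alone; a
   Gershgorin argument for the Fejer kernel then applies. *)
Require Import Defs.
From mathcomp Require Import all_boot all_order all_algebra.
From mathcomp Require Import spectral sesquilinear.
From mathcomp Require Import boolp classical_sets reals constructive_ereal ereal.
From mathcomp Require Import topology normedtype derive exp trigo.
From mathcomp Require Import ring lra zify.
From mathcomp.real_closed Require Import complex.
Set Implicit Arguments.
Unset Strict Implicit.
Unset Printing Implicit Defensive.
Import Order.TTheory GRing.Theory Num.Theory.
Import ComplexField.Normc numFieldNormedType.Exports.
Local Open Scope ring_scope.

(** * Elementary trigonometric bounds *)

Section RealTrigonometry.
Variable R : realType.
Implicit Types x t : R.

(** Starting from [sin_le_id], repeated use integrates each Taylor inequality of sine and cosine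
    into the next one. *)
Lemma ge0_of_derive (f df : R -> R) :
  (forall x, is_derive x 1 f (df x)) -> f 0 = 0 ->
  (forall x, 0 <= x -> 0 <= df x) -> forall x, 0 <= x -> 0 <= f x.
Proof.
move=> fdf f0 df0 x x0; rewrite -[leLHS]f0.
apply: (@ger0_derive1_ndecr _ f 0 x) => // [y|].
- rewrite in_itv /= => /andP[y0 _]; rewrite derive1E.
  by have := fdf y => /@derive_val ->; apply: df0; exact: ltW.
- apply: continuous_subspaceT => y; apply: differentiable_continuous.
  by apply/derivable1_diffP; have := fdf y => -[].
Qed.

Lemma sin_le_id x : 0 <= x -> sin x <= x.
Proof.
move=> x0; rewrite -subr_ge0.
apply: (@ge0_of_derive (fun x => x - sin x) (fun x => 1 - cos x)) => //.
by rewrite sin0 subr0.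
Qed.

Lemma cos_ge_taylor2 x : 0 <= x -> 1 - x ^+ 2 / 2 <= cos x.
Proof.
move=> x0; rewrite -subr_ge0.
apply: (@ge0_of_derive (fun x => cos x - (1 - x ^+ 2 / 2)) (fun x => x - sin x))
  => // [y||y y0].
- by apply: is_derive_eq; rewrite /GRing.scale /=; lra.
- by rewrite cos0; lra.
- by rewrite subr_ge0 sin_le_id.
Qed.

Lemma sin_ge_taylor3 x : 0 <= x -> x - x ^+ 3 / 6 <= sin x.
Proof.
move=> x0; rewrite -subr_ge0.
apply: (@ge0_of_derive (fun x => sin x - (x - x ^+ 3 / 6))
          (fun x => cos x - (1 - x ^+ 2 / 2))) => // [y||y y0].
- by apply: is_derive_eq; rewrite /GRing.scale /=; lra.
- by rewrite sin0; lra.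
- by rewrite subr_ge0 cos_ge_taylor2.
Qed.

Lemma cos_le_taylor4 x : 0 <= x -> cos x <= 1 - x ^+ 2 / 2 + x ^+ 4 / 24.
Proof.
move=> x0; rewrite -subr_ge0.
apply: (@ge0_of_derive (fun x => 1 - x ^+ 2 / 2 + x ^+ 4 / 24 - cos x)
          (fun x => sin x - (x - x ^+ 3 / 6))) => // [y||y y0].
- by apply: is_derive_eq; rewrite /GRing.scale /=; lra.
- by rewrite cos0; lra.
- by rewrite subr_ge0 sin_ge_taylor3.
Qed.

(** If 17/10 were at most pi/2, its cosine would be nonnegative, but the fourth-order Taylor bound
    is already negative there. *)
Lemma pi_lt : pi < 17 / 5 :> R.
Proof.
rewrite ltNge; apply/negP => h.
have := @cos_le_taylor4 (17 / 10); have : 0 <= cos (17 / 10 : R); last by lra.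
apply: cos_ge0_pihalf; apply/andP; split; have := @pi_ge2 R; lra.
Qed.

(** For x = pi t one has x^2 <= 3, so the cubic Taylor bound is at least x / 2, which dominates t
    because pi >= 2. *)
Lemma sin_pi_ge t : 0 <= t <= 1 / 2 -> t <= sin (pi * t).
Proof.
move=> /andP[t0 t1]; have p1 := pi_lt; have p2 := @pi_ge2 R.
have x0 : 0 <= pi * t by nra.
apply: le_trans (sin_ge_taylor3 x0).
have x1 : pi * t <= 17 / 10 by nra.
have xt : 2 * t <= pi * t by nra.
move: (pi * t) x0 x1 xt => x x0 x1 xt.
have x2 : x ^+ 2 <= 3 by nra.
have : 0 <= x * (3 - x ^+ 2) by rewrite mulr_ge0 // subr_ge0.
by rewrite (_ : x ^+ 3 = x * x ^+ 2); [lra | ring].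
Qed.

(** Squaring the cubic Taylor bound gives (1 - x^2/6)^2 >= 1 - x^2/3 with x <= pi / lam. This is the
    source of the factor 1 - pi^2 / (3 lambda^2) in [B_const]. *)
Lemma sin_pi_sqr_ge (lam : nat) t : (1 < lam)%N -> 0 <= t <= lam%:R^-1 ->
  (pi * t) ^+ 2 * (1 - pi ^+ 2 / (3 * lam%:R ^+ 2)) <= sin (pi * t) ^+ 2.
Proof.
move=> lam2 /andP[t0 t1]; have p1 := pi_lt; have p2 := @pi_ge2 R.
have x0 : 0 <= pi * t by nra.
have l2 : 2 <= lam%:R :> R by rewrite ler_nat.
have li : lam%:R^-1 <= 1 / 2 :> R.
  by rewrite mul1r lef_pV2 ?posrE //; lra.
have li0 : 0 < lam%:R^-1 :> R by rewrite invr_gt0; lra.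
have x1 : pi * t <= 17 / 10 by nra.
have s := sin_ge_taylor3 x0.
have e : pi ^+ 2 / (3 * lam%:R ^+ 2) = (pi * lam%:R^-1) ^+ 2 / 3 :> R.
  by field; lra.
have xl : pi * t <= pi * lam%:R^-1 by rewrite ler_wpM2l //; lra.
rewrite e; move: (pi * t) (pi / lam%:R) x0 x1 s xl => x y x0 x1 s xl.
have x2 : x ^+ 2 <= 3 by nra.
have x3 : x ^+ 3 = x * x ^+ 2 by ring.
have h0 : 0 <= x - x ^+ 3 / 6.
  have : 0 <= x * (3 - x ^+ 2) by rewrite mulr_ge0 // subr_ge0.
  by rewrite x3; lra.
have h1 : (x - x ^+ 3 / 6) ^+ 2 <= sin x ^+ 2.
  by rewrite ler_pXn2r // nnegrE //; lra.
apply: le_trans h1; rewrite x3.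
have xy : x ^+ 2 <= y ^+ 2 by rewrite ler_pXn2r // nnegrE; lra.
rewrite (_ : (x - x * x ^+ 2 / 6) ^+ 2 = x ^+ 2 * (1 - x ^+ 2 / 6) ^+ 2); last by ring.
apply: ler_wpM2l; first exact: sqr_ge0.
rewrite (_ : (1 - x ^+ 2 / 6) ^+ 2 = 1 - x ^+ 2 / 3 + (x ^+ 2 / 6) ^+ 2); last by field.
have := sqr_ge0 (x ^+ 2 / 6); lra.
Qed.

End RealTrigonometry.

(** * Complex moduli and points of the unit circle *)

Section ComplexModulus.
Variable R : realType.
Implicit Types z w : R[i].

Lemma normc_ge0 z : 0 <= normc z.
Proof. by case: z => a b; exact: sqrtr_ge0. Qed.

Lemma normc_sqr z : (normc z ^+ 2)%:C%C = z * z^*.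
Proof. by rewrite rmorphXn /= -[LHS]/(`|z| ^+ 2) normCK. Qed.

Lemma normcX z n : normc (z ^+ n) = normc z ^+ n.
Proof. by elim: n => [|n IH]; rewrite ?expr0 ?normc1 // !exprS normcM IH. Qed.

Lemma normc_prod (I : Type) (r : seq I) (P : pred I) (F : I -> R[i]) :
  normc (\prod_(i <- r | P i) F i) = \prod_(i <- r | P i) normc (F i).
Proof. by apply: (big_morph _ (@normcM R) (@normc1 R)). Qed.

Lemma normcD_le z w : normc (z + w) <= normc z + normc w.
Proof. exact: le_normcD. Qed.

Lemma normcB_sym z w : normc (z - w) = normc (w - z).
Proof. by rewrite -(normcN (z - w)); congr normc; rewrite opprB. Qed.

Lemma normc_sum_le (I : Type) (r : seq I) (P : pred I) (F : I -> R[i]) :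
  normc (\sum_(i <- r | P i) F i) <= \sum_(i <- r | P i) normc (F i).
Proof.
elim/big_ind2: _ => [|x1 x2 y1 y2 h1 h2|//]; first by rewrite normc0.
by apply: le_trans (normcD_le _ _) _; exact: lerD.
Qed.

Lemma normc_conj z : normc z^* = normc z.
Proof. by case: z => a b; rewrite /= sqrrN. Qed.

Lemma normc_real (x : R) : normc (x%:C)%C = `|x|.
Proof. by rewrite /= expr0n addr0 sqrtr_sqr. Qed.

Lemma normc_nat n : normc (n%:R : R[i]) = n%:R.
Proof. by rewrite -(rmorph_nat (real_complex R)) normc_real normr_nat. Qed.

Lemma normc_eq0 z : (normc z == 0) = (z == 0).
Proof.
by apply/eqP/eqP => [/eq0_normc|->] //; exact: normc0.
Qed.

Lemma le_real_normc (x : R) z : (x%:C)%C = z -> x <= normc z.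
Proof. by move=> <-; rewrite normc_real ler_norm. Qed.

End ComplexModulus.

(** * Cauchy-Schwarz inequality for finite sums *)

Section CauchySchwarzSums.
Variables (R : realType) (I : finType).
Implicit Types a b : I -> R.

(** Lagrange's identity: the defect is half the double sum of the squares (a_i b_j - a_j b_i)^2. *)
Lemma sum_mul_sqr_le a b :
  (\sum_i a i * b i) ^+ 2 <= (\sum_i a i ^+ 2) * (\sum_i b i ^+ 2).
Proof.
have h : 0 <= \sum_i \sum_j (a i * b j - a j * b i) ^+ 2.
  by do 2! apply: sumr_ge0 => ? _; exact: sqr_ge0.
suff e : \sum_i \sum_j (a i * b j - a j * b i) ^+ 2 =
    2 * ((\sum_i a i ^+ 2) * (\sum_i b i ^+ 2) - (\sum_i a i * b i) ^+ 2).
  by move: h; rewrite e; lra.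
under eq_bigr => i _.
  under eq_bigr => j _.
    rewrite (_ : _ ^+ 2 = (a i ^+ 2 * b j ^+ 2 + a j ^+ 2 * b i ^+ 2)
       - 2 * ((a i * b i) * (a j * b j))); last by ring.
    over.
  rewrite big_split /= sumrN big_split /= -!mulr_sumr -mulr_suml.
  over.
rewrite big_split /= sumrN big_split /= -!mulr_suml -!mulr_sumr -mulr_suml.
by rewrite expr2; ring.
Qed.

Lemma sum_mul_le a b : (forall i, 0 <= a i) -> (forall i, 0 <= b i) ->
  \sum_i a i * b i <= Num.sqrt (\sum_i a i ^+ 2) * Num.sqrt (\sum_i b i ^+ 2).
Proof.
move=> a0 b0; rewrite -sqrtrM ?sumr_ge0 // => [|i _]; last exact: sqr_ge0.
rewrite -[leLHS]ger0_norm; last by apply: sumr_ge0 => i _; rewrite mulr_ge0.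
by rewrite -sqrtr_sqr ler_wsqrtr // sum_mul_sqr_le.
Qed.

Lemma sum_sqr_le a : (\sum_i a i) ^+ 2 <= #|I|%:R * \sum_i a i ^+ 2.
Proof.
have := sum_mul_sqr_le a (fun=> 1).
under eq_bigr do rewrite mulr1.
by rewrite expr1n sumr_const mulrC.
Qed.

End CauchySchwarzSums.

(** * Points of the unit circle and distances on the torus *)

Section Circle.
Variable R : realType.
Implicit Types a b w t : R.

Lemma expiD a b : expi (a + b) = expi a * expi b.
Proof.
rewrite /expi cosD sinD; apply/eqP; rewrite eq_complex /=; apply/andP.
by split; apply/eqP; ring.
Qed.

Lemma expi0 : expi (0 : R) = 1.
Proof. by rewrite /expi cos0 sin0. Qed.

Lemma conj_expi a : (expi a)^* = expi (- a).
Proof. by rewrite /expi cosN sinN. Qed.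

Lemma normc_expi a : normc (expi a) = 1.
Proof. by rewrite /= cos2Dsin2 sqrtr1. Qed.

Definition circle w : R[i] := expi (- (2 * pi * w)).

Lemma circleD a b : circle (a + b) = circle a * circle b.
Proof. by rewrite /circle -expiD; congr expi; ring. Qed.

Lemma circle0 : circle 0 = 1.
Proof. by rewrite /circle mulr0 oppr0 expi0. Qed.

Lemma circleN a : circle (- a) = (circle a)^*.
Proof. by rewrite /circle conj_expi; congr expi; ring. Qed.

Lemma circleMn n a : circle (n%:R * a) = circle a ^+ n.
Proof.
elim: n => [|n IH]; first by rewrite mul0r circle0 expr0.
by rewrite exprS -IH -circleD -natr1; congr circle; ring.
Qed.

Lemma expi_circle n a : expi (- (2 * pi * n%:R * a)) = circle a ^+ n.
Proof. by rewrite -circleMn /circle; congr expi; ring. Qed.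

Lemma normc_circle a : normc (circle a) = 1.
Proof. exact: normc_expi. Qed.

Lemma circle_int (n : int) : circle n%:~R = 1.
Proof.
have h (m : nat) : circle m%:R = 1.
  rewrite -[m%:R]mulr1 circleMn (_ : circle 1 = 1) ?expr1n //.
  rewrite /circle mulr1 /expi cosN sinN mulrC mulr_natr cos2pi sin2pi oppr0.
  by [].
case: n => m; first exact: h.
by rewrite NegzE mulrNz circleN h rmorph1.
Qed.

Lemma normc_circleB a b :
  normc (circle a - circle b) = 2 * `|sin (pi * (a - b))|.
Proof.
rewrite -[2 in RHS]ger0_norm // -normrM -sqrtr_sqr /circle /expi /=.
congr Num.sqrt; rewrite !cosN !sinN.
set x := 2 * pi * a; set y := 2 * pi * b.
have e : cos (x - y) = 1 - 2 * sin (pi * (a - b)) ^+ 2.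
  rewrite (_ : x - y = (pi * (a - b)) *+ 2); last by rewrite /x /y; ring.
  by rewrite cos_mulr2n cos2sin2; ring.
rewrite exprMn; move: e; rewrite cosB => e.
have := cos2Dsin2 x; have := cos2Dsin2 y; move: e.
move: (cos x) (sin x) (cos y) (sin y) (sin (pi * (a - b))) => cx sx cy sy s e h1 h2.
have -> : (cx - cy) ^+ 2 + (- sx - - sy) ^+ 2 =
  (cx ^+ 2 + sx ^+ 2) + (cy ^+ 2 + sy ^+ 2) - 2 * (cx * cy + sx * sy) by ring.
by rewrite h1 h2 e; ring.
Qed.

Lemma circleD_int a (n : int) : circle (a + n%:~R) = circle a.
Proof. by rewrite circleD circle_int mulr1. Qed.

(** The integer n is explicit so that a chosen representative of the difference can replace the
    infimum [Tnorm]. *)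
Lemma circle_dist_ge a b (n : int) : `|a - b - n%:~R| <= 1 / 2 ->
  2 * `|a - b - n%:~R| <= normc (circle a - circle b).
Proof.
move=> h; rewrite -(circleD_int b n) normc_circleB opprD addrA.
move: (a - b - n%:~R) h => t h; rewrite ler_pM2l //.
have -> : `|sin (pi * t)| = `|sin (pi * `|t|)|.
  case: (ger0P t) => t0 //.
  by rewrite mulrN sinN normrN.
by apply: le_trans (ler_norm _); rewrite sin_pi_ge // normr_ge0.
Qed.

Lemma nearest_int t : exists n : int, `|t - n%:~R| <= 1 / 2.
Proof.
exists (Num.floor (t + 1 / 2)); have := floor_itv (t + 1 / 2).
by rewrite ler_norml intrD => /andP[h1 h2]; apply/andP; split; lra.
Qed.

Lemma Tnorm_le w (n : int) : Tnorm w <= `|w - n%:~R|.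
Proof.
apply: ge_inf; last by exists n.
by exists 0 => _ [m _ <-]; exact: normr_ge0.
Qed.

Lemma Tnorm_le_half w : Tnorm w <= 1 / 2.
Proof. by have [n h] := nearest_int w; apply: le_trans h; exact: Tnorm_le. Qed.

Lemma Tnorm_circle a b : 2 * Tnorm (a - b) <= normc (circle a - circle b).
Proof.
have [n h] := nearest_int (a - b).
by apply: le_trans (circle_dist_ge h); rewrite ler_pM2l // Tnorm_le.
Qed.

Lemma circle_eq a b : circle a = circle b -> exists n : int, a - b = n%:~R.
Proof.
move=> e; have [n h] := nearest_int (a - b); exists n.
have := circle_dist_ge h; rewrite e subrr normc0 => h0.
by apply/eqP; rewrite -subr_eq0 -normr_le0; lra.
Qed.

End Circle.

(** * Discrete Parseval identity and duality *)

Section Duality.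
Variable R : realType.
Implicit Types (p q : {poly R[i]}) (N : nat).

(** Orthogonality of characters on the N-th roots of unity: off the diagonal the terms are the
    powers of a nontrivial root [w], whose geometric sum vanishes. *)
Lemma circle_sum_roots (N i j : nat) : (i < N)%N -> (j < N)%N ->
  \sum_(r < N) (circle (r%:R / N%:R : R) ^+ i * (circle (r%:R / N%:R : R) ^+ j)^*)
    = (if i == j then N%:R else 0) :> R[i].
Proof.
move=> iN jN; have N0 : N%:R != 0 :> R by rewrite pnatr_eq0; lia.
pose w : R[i] := circle ((i%:R - j%:R) / N%:R).
have e (r : 'I_N) : circle (r%:R / N%:R : R) ^+ i * (circle (r%:R / N%:R : R) ^+ j)^*
    = w ^+ r.
  rewrite -!circleMn -circleN -circleD; congr circle; by field.
under eq_bigr do rewrite e.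
case: eqP => [ij|/eqP ij].
  have -> : w = 1 by rewrite /w ij subrr mul0r circle0.
  under eq_bigr do rewrite expr1n.
  by rewrite sumr_const card_ord.
have w1 : w != 1.
  apply/eqP; rewrite -(circle0 R) => /circle_eq[n].
  rewrite subr0 => /(congr1 ( *%R^~ N%:R)); rewrite divfK // => h.
  have {}h : (i%:Z - j%:Z)%:~R = (n * N%:Z)%:~R :> R.
    by rewrite intrM intrB -!pmulrn.
  move/eqP: h; rewrite eqr_int => /eqP h.
  have : (n = 0)%R by nia.
  by move: h ij; nia.
apply: (mulfI (_ : w - 1 != 0)); first by rewrite subr_eq0.
rewrite mulr0 -subrX1 /w -circleMn.
have -> : N%:R * ((i%:R - j%:R) / N%:R) = (i%:Z - j%:Z)%:~R :> R.
  by rewrite intrB -!pmulrn; field.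
by rewrite circle_int subrr.
Qed.

Lemma parseval N p : (size p <= N)%N ->
  \sum_(r < N) normc p.[circle (r%:R / N%:R)] ^+ 2
    = N%:R * \sum_(i < N) normc p`_i ^+ 2.
Proof.
move=> sp; apply: (@complexI R); rewrite rmorphM !rmorph_sum /= rmorph_nat.
under eq_bigr => r _.
  rewrite normc_sqr (horner_coef_wide _ sp) rmorph_sum mulr_suml.
  under eq_bigr => i _.
    rewrite mulr_sumr.
    under eq_bigr => j _ do rewrite rmorphM mulrACA.
    over.
  over.
rewrite exchange_big mulr_sumr; apply: eq_bigr => i _ /=.
rewrite exchange_big (bigD1 i) //= -mulr_sumr circle_sum_roots // eqxx.
rewrite big1 ?addr0 ?normc_sqr 1?mulrC // => j ji.
by rewrite -mulr_sumr circle_sum_roots // val_eqE eq_sym (negbTE ji) mulr0.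
Qed.

(** Domination on the unit circle passes to coefficient norms through Parseval at the N-th roots of
    unity. *)
Lemma coef_norm_le N p q (c : R) : (0 < N)%N -> (size p <= N)%N -> (size q <= N)%N ->
  0 <= c -> (forall w : R, normc p.[circle w] <= c * normc q.[circle w]) ->
  \sum_(i < N) normc p`_i ^+ 2 <= c ^+ 2 * \sum_(i < N) normc q`_i ^+ 2.
Proof.
move=> N0 sp sq c0 h; have N0' : 0 < N%:R :> R by rewrite ltr0n.
rewrite -(ler_pM2l N0') mulrCA -!parseval // mulr_sumr.
apply: ler_sum => r _; rewrite -exprMn ler_pXn2r ?nnegrE ?normc_ge0 //.
by rewrite mulr_ge0 ?normc_ge0.
Qed.

(* Pairing sum_j conj(v_j) p_j with the Vandermonde image of v recovers |v|^2
   up to eps. *)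
Lemma vandermonde_lower_bound (S N : nat) (z v : 'I_S -> R[i])
    (p : 'I_S -> {poly R[i]}) (eps K : R) :
  (forall j, (size (p j) <= N)%N) -> 0 <= eps -> eps <= 1 ->
  (forall j k, S%:R * normc ((p j).[z k] - (j == k)%:R) <= eps) ->
  \sum_j \sum_(i < N) normc (p j)`_i ^+ 2 <= K ->
  (1 - eps) ^+ 2 * (\sum_j normc (v j) ^+ 2)
    <= K * \sum_(m < N) normc (\sum_k z k ^+ m * v k) ^+ 2.
Proof.
move=> sp eps0 eps1 hE hK.
set V := \sum_j normc (v j) ^+ 2; set Y := \sum_(m < N) _.
have V0 : 0 <= V by apply: sumr_ge0 => i _; exact: sqr_ge0.
have Y0 : 0 <= Y by apply: sumr_ge0 => i _; exact: sqr_ge0.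
have K0 : 0 <= K.
  by apply: le_trans hK; do 2!apply: sumr_ge0 => ? _; exact: sqr_ge0.
pose y (m : 'I_N) := \sum_k z k ^+ m * v k.
pose n (j : 'I_S) : R := Num.sqrt (\sum_(i < N) normc (p j)`_i ^+ 2).
pose T := \sum_j (v j)^* * \sum_(m < N) (p j)`_m * y m.
(* [D] collects the deviations of the values p_j(z_k) from the Kronecker delta. *)
pose D := \sum_j \sum_k (v j)^* * v k * ((p j).[z k] - (j == k)%:R).
have eT : T = (V%:C)%C + D.
  have -> : (V%:C)%C = \sum_j \sum_k (v j)^* * v k * (j == k)%:R.
    rewrite rmorph_sum; apply: eq_bigr => j _.
    rewrite (bigD1 j) //= eqxx mulr1 big1 ?addr0 => [|k kj].
      by rewrite normc_sqr mulrC.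
    by rewrite eq_sym (negbTE kj) mulr0.
  rewrite -big_split; apply: eq_bigr => j _ /=.
  rewrite -big_split /=.
  under [RHS]eq_bigr => k _ do rewrite -mulrDr addrCA subrr addr0 -mulrA.
  rewrite -mulr_sumr; congr (_ * _).
  under eq_bigr => m _ do rewrite mulr_sumr.
  rewrite exchange_big; apply: eq_bigr => k _ /=.
  rewrite (horner_coef_wide _ (sp j)) mulr_sumr.
  by apply: eq_bigr => m _; ring.
have hD : normc D <= eps * V.
  apply: le_trans (normc_sum_le _ _ _) _.
  apply: (@le_trans _ _ (\sum_j \sum_k normc (v j) * normc (v k) * (eps / S%:R))).
    apply: ler_sum => j _; apply: le_trans (normc_sum_le _ _ _) _.
    apply: ler_sum => k _; rewrite !normcM normc_conj.
    apply: ler_wpM2l; first by rewrite mulr_ge0 ?normc_ge0.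
    rewrite ler_pdivlMr ?ltr0n; last by case: (S) j => [[]|].
    by rewrite mulrC.
  under eq_bigr => j _ do rewrite -mulr_suml -mulr_sumr.
  rewrite -!mulr_suml -expr2 mulrCA; apply: ler_wpM2l => //.
  (* Cauchy-Schwarz bounds the square of the sum of the |v_j| by S V, and S cancels the 1 / S
     granted to each deviation. *)
  have := sum_sqr_le (fun j => normc (v j)); rewrite card_ord -/V => h.
  have [S0|S0] := posnP S.
    by rewrite [X in X%:R]S0 invr0 mulr0.
  by rewrite ler_pdivrMr ?ltr0n // mulrC.
have hT : normc T <= Num.sqrt V * Num.sqrt K * Num.sqrt Y.
  apply: (@le_trans _ _ (\sum_j normc (v j) * n j * Num.sqrt Y)).
    apply: le_trans (normc_sum_le _ _ _) _; apply: ler_sum => j _.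
    rewrite normcM normc_conj -mulrA; apply: ler_wpM2l; first exact: normc_ge0.
    apply: le_trans (normc_sum_le _ _ _) _.
    under eq_bigr do rewrite normcM.
    by apply: sum_mul_le => i; exact: normc_ge0.
  rewrite -mulr_suml; apply: ler_wpM2r; first exact: sqrtr_ge0.
  apply: le_trans (sum_mul_le _ _) _ => [j|j|]; rewrite ?normc_ge0 ?sqrtr_ge0 //.
  apply: ler_wpM2l; first exact: sqrtr_ge0.
  apply: ler_wsqrtr; apply: le_trans hK; apply: ler_sum => j _.
  by rewrite sqr_sqrtr //; apply: sumr_ge0 => i _; exact: sqr_ge0.
have h1 : (1 - eps) * V <= Num.sqrt V * Num.sqrt K * Num.sqrt Y.
  apply: le_trans hT.
  have h : V <= normc T + normc D.
    rewrite -(normcN D); apply: le_trans (normcD_le _ _).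
    by apply: le_real_normc; rewrite eT addrK.
  by lra.
have [V00|Vn0] := eqVneq V 0; first by rewrite V00 mulr0 mulr_ge0.
have Vp : 0 < V by rewrite lt_def Vn0.
have sV : 0 < Num.sqrt V by rewrite sqrtr_gt0.
have h2 : (1 - eps) * Num.sqrt V <= Num.sqrt K * Num.sqrt Y.
  rewrite -(ler_pM2l sV); move: h1; rewrite -{1}(sqr_sqrtr V0) mulrA.
  by congr (_ <= _); ring.
have : ((1 - eps) * Num.sqrt V) ^+ 2 <= (Num.sqrt K * Num.sqrt Y) ^+ 2.
  by rewrite ler_pXn2r // nnegrE mulr_ge0 ?sqrtr_ge0 // subr_ge0.
by rewrite !exprMn !sqr_sqrtr.
Qed.

End Duality.

(** * Interpolating trigonometric polynomials *)

Section InterpolatingPolynomials.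
Variable R : realType.

(** The Dirichlet kernel as a polynomial, centred at the node of [b] and normalised to the value 1
    there. *)
Definition dirichlet (P : nat) (b : R) : {poly R[i]} :=
  \poly_(i < P.+1) (circle (- b) ^+ i / P.+1%:R).

Lemma horner_dirichlet P b z : (dirichlet P b).[z] =
  (\sum_(i < P.+1) (circle (- b) * z) ^+ i) / P.+1%:R.
Proof.
rewrite horner_poly mulr_suml; apply: eq_bigr => i _.
by rewrite exprMn; ring.
Qed.

Lemma dirichlet_node P b : (dirichlet P b).[circle b] = 1.
Proof.
rewrite horner_dirichlet -circleD addNr circle0.
under eq_bigr do rewrite expr1n.
by rewrite sumr_const card_ord divff // pnatr_eq0.
Qed.

Lemma dirichlet_le1 P b w : normc (dirichlet P b).[circle w] <= 1.
Proof.
rewrite horner_dirichlet -circleD normcM normcV normc_nat ler_pdivrMr ?ltr0n //.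
rewrite mul1r; apply: le_trans (normc_sum_le _ _ _) _.
under eq_bigr do rewrite normcX normc_circle expr1n.
by rewrite sumr_const card_ord.
Qed.

(** Multiplied by u - 1, the geometric sum becomes u^(P+1) - 1, of modulus at most 2, and |u - 1| is
    the chord between the two points. *)
Lemma dirichlet_decay P b w (t : R) : 0 < t -> t <= normc (circle w - circle b) ->
  normc (dirichlet P b).[circle w] <= 2 / (t * P.+1%:R).
Proof.
move=> t0 ht; rewrite horner_dirichlet -circleD normcM normcV normc_nat.
rewrite [2 / _]mulrC invfM mulrAC; apply: ler_wpM2r.
  by rewrite invr_ge0 ler0n.
rewrite mulrC ler_pdivlMr //.
set u := circle (- b + w); set s := \sum_(i < _) _.
apply: (@le_trans _ _ (normc s * normc (u - 1))).
  apply: ler_wpM2l; first exact: normc_ge0.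
  apply: le_trans ht _; rewrite /u circleD.
  have -> : circle w - circle b = circle b * (circle (- b) * circle w - 1).
    by rewrite mulrBr mulrA -circleD subrr circle0 mul1r mulr1.
  by rewrite normcM normc_circle mul1r.
rewrite -normcM mulrC -subrX1.
apply: le_trans (normcD_le _ _) _.
by rewrite normcX normc_circle expr1n normcN normc1.
Qed.

Lemma dirichlet_coef_norm P b N : (P < N)%N ->
  \sum_(i < N) normc (dirichlet P b)`_i ^+ 2 = P.+1%:R^-1.
Proof.
move=> PN; rewrite -(big_mkord xpredT (fun i => normc (dirichlet P b)`_i ^+ 2)).
rewrite (big_cat_nat (n := P.+1)) //= [X in _ + X]big_nat_cond [X in _ + X]big1 ?addr0; last first.
  by move=> i /andP[/andP[Pi _] _]; rewrite coef_poly ifN ?normc0 ?expr0n // -leqNgt.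
rewrite big_mkord.
under eq_bigr => i _.
  rewrite coef_poly ltn_ord normcM normcV normc_nat normcX normc_circle expr1n.
  over.
by rewrite sumr_const card_ord mul1r -[LHS]mulr_natr expr2 -mulrA mulVf ?mulr1 ?pnatr_eq0.
Qed.

Variables (S : nat) (omega : 'I_S -> R).
Implicit Types (Lam : {set 'I_S}) (j k : 'I_S).

(** Bounds one factor of [lagrange] on the unit circle, where its numerator has modulus at most
    2. *)
Definition lagrange_factor (Q : nat) j k : R :=
  2 / normc (circle (Q%:R * omega j) - circle (Q%:R * omega k)).

Definition lagrange (Q : nat) Lam j : {poly R[i]} :=
  \prod_(k in Lam :\ j) ((circle (Q%:R * omega j) - circle (Q%:R * omega k))^-1
     *: ('X^Q - (circle (Q%:R * omega k))%:P)).

Lemma size_lagrange Q Lam j : (0 < Q)%N -> j \in Lam ->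
  (size (lagrange Q Lam j) <= (Q * (#|Lam| - 1)).+1)%N.
Proof.
move=> Q0 jL; apply: leq_trans (size_prod_leq _ _) _.
have h : (\sum_(k in Lam :\ j) size ((circle (Q%:R * omega j) - circle (Q%:R * omega k))^-1
     *: ('X^Q - (circle (Q%:R * omega k))%:P)) <= #|Lam :\ j| * Q.+1)%N.
  rewrite -sum_nat_const; apply: leq_sum => k _.
  by apply: leq_trans (size_scale_leq _ _) _; rewrite size_XnsubC.
have e : #|Lam| = (#|Lam :\ j|).+1 by rewrite (cardsD1 j) jL.
rewrite e; move: h; set X := (\sum_(k in _) _)%N.
change (fun i : 'I_S => i \in Lam :\ j) with (mem (Lam :\ j)).
by move: X #|_| => X c; lia.
Qed.

Lemma horner_lagrange Q Lam j z : (lagrange Q Lam j).[z] =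
  \prod_(k in Lam :\ j) ((circle (Q%:R * omega j) - circle (Q%:R * omega k))^-1
     * (z ^+ Q - circle (Q%:R * omega k))).
Proof. by rewrite horner_prod; apply: eq_bigr => k _; rewrite !hornerE. Qed.

Lemma lagrange_le Q Lam j w :
  normc (lagrange Q Lam j).[circle w] <= \prod_(k in Lam :\ j) lagrange_factor Q j k.
Proof.
rewrite horner_lagrange normc_prod; apply: ler_prod => k _.
rewrite normc_ge0 normcM normcV mulrC /lagrange_factor; apply: ler_wpM2r.
  by rewrite invr_ge0 normc_ge0.
apply: le_trans (normcD_le _ _) _.
by rewrite normcN normcX !normc_circle expr1n.
Qed.

(** The witness is the Lagrange polynomial of the clump times the n-th power of the Dirichlet kernel
    at [omega j]. The first factor vanishes on the rest of the clump, the second decays away from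
    [omega j]. *)
Lemma clump_polynomial (L P Q n : nat) Lam j : (0 < Q)%N -> (0 < n)%N ->
  j \in Lam -> (Q * (#|Lam| - 1) + n * P <= L)%N ->
  (forall k, k \in Lam -> k != j ->
     circle (Q%:R * omega j) != circle (Q%:R * omega k)) ->
  exists p : {poly R[i]},
  [/\ (size p <= L.+1)%N, p.[circle (omega j)] = 1,
      forall k, k \in Lam -> k != j -> p.[circle (omega k)] = 0,
      forall w t, 0 < t -> t <= normc (circle w - circle (omega j)) ->
        normc p.[circle w] <=
          \prod_(k in Lam :\ j) lagrange_factor Q j k * (2 / (t * P.+1%:R)) ^+ n &
      \sum_(i < L.+1) normc p`_i ^+ 2 <=
        (\prod_(k in Lam :\ j) lagrange_factor Q j k) ^+ 2 / P.+1%:R].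
Proof.
move=> Q0 n0 jL hL hne.
set g := \prod_(k in _) _.
have g0 : 0 <= g by apply: prodr_ge0 => k _; rewrite divr_ge0 ?normc_ge0.
set d := dirichlet P (omega j).
have sd : (size d <= P.+1)%N by exact: size_poly.
have sdn : (size (d ^+ n) <= (n * P).+1)%N.
  apply: leq_trans (size_exp_leq _ _) _; rewrite ltnS mulnC leq_mul2l.
  by rewrite -subn1 leq_subLR add1n sd orbT.
have sp : (size (lagrange Q Lam j * d ^+ n)%R <= L.+1)%N.
  apply: leq_trans (size_polyMleq _ _) _.
  have sl := size_lagrange Q0 jL; rewrite -subn1 leq_subLR add1n.
  apply: leq_trans (leq_add sl sdn) _; rewrite addSn addnS !ltnS; exact: hL.
exists (lagrange Q Lam j * d ^+ n); split => //.
- rewrite hornerM horner_exp dirichlet_node expr1n mulr1 horner_lagrange.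
  apply: big1 => k; rewrite in_setD1 => /andP[kj kL].
  by rewrite -circleMn mulVf // subr_eq0 hne.
- move=> k kL kj; rewrite hornerM horner_lagrange (bigD1 k) ?in_setD1 ?kj //=.
  by rewrite -circleMn subrr mulr0 !mul0r.
- move=> w t t0 ht; rewrite hornerM horner_exp normcM normcX.
  apply: ler_pM; rewrite ?exprn_ge0 ?normc_ge0 ?lagrange_le //.
  by rewrite ler_pXn2r ?nnegrE ?normc_ge0 ?dirichlet_decay // divr_ge0 ?mulr_ge0 // ltW.
- have PL : (P < L.+1)%N by move: hL n0; nia.
  (* On the circle the Lagrange part is at most g and n - 1 of the kernels are at most 1, so the
     comparison is with a single kernel. *)
  apply: le_trans (@coef_norm_le _ L.+1 _ d g _ sp _ g0 _) _ => // [|w|].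
  + exact: leq_trans sd _.
  + rewrite hornerM horner_exp normcM normcX; apply: ler_pM;
      rewrite ?exprn_ge0 ?normc_ge0 ?lagrange_le //.
    case: (n) n0 => // m _; rewrite exprS -[leRHS]mulr1; apply: ler_wpM2l.
      exact: normc_ge0.
    by apply: exprn_ile1; rewrite ?normc_ge0 ?dirichlet_le1.
  + by rewrite dirichlet_coef_norm.
Qed.

End InterpolatingPolynomials.

(** * Sorted nodes of a clump *)

Section SortedGaps.
Variables (R : realType) (S : nat).
Implicit Types (Lam : {set 'I_S}) (tau : 'I_S -> R).

(** After sorting by [tau], consecutive values differ by at least delta, and these steps add up
    along the sequence. *)
Lemma sorted_gaps Lam tau (delta : R) :
  (forall j k, j \in Lam -> k \in Lam -> j != k -> delta <= `|tau j - tau k|) ->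
  exists s : seq 'I_S, perm_eq s (enum Lam) /\
    forall x0 i l, (i < l)%N -> (l < size s)%N ->
      delta * (l%:R - i%:R) <= tau (nth x0 s l) - tau (nth x0 s i).
Proof.
move=> h; pose le j k := tau j <= tau k.
have tot : total le by move=> j k; exact: le_total.
exists (sort le (enum Lam)); split; first by rewrite perm_sort.
move=> x0; set s := sort le _.
have us : uniq s by rewrite sort_uniq enum_uniq.
have ins i : (i < size s)%N -> nth x0 s i \in Lam.
  by move=> hi; rewrite -mem_enum -(mem_sort le) mem_nth.
have st : sorted le s by apply: sort_sorted.
have tr : transitive le by move=> j k l; exact: le_trans.
have step i : (i.+1 < size s)%N -> delta <= tau (nth x0 s i.+1) - tau (nth x0 s i).
  move=> hi; have hi' : (i < size s)%N by apply: ltnW.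
  have : le (nth x0 s i) (nth x0 s i.+1).
    by apply: (sorted_ltn_nth tr) => //.
  rewrite /le -subr_ge0 => /ger0_norm <-; apply: h; rewrite ?ins //.
  by rewrite nth_uniq // neq_ltn ltnSn orbT.
move=> i l; elim: l => // l IH il hl.
have hs := step l hl.
have [e|il'] := leqP l i.
  have -> : i = l by lia.
  by rewrite -natr1; lra.
have := IH il' (ltnW hl); rewrite -natr1; lra.
Qed.

(** In increasing order of [tau], nodes of ranks i and l are at least delta |i - l| apart, so each
    factor is at most c / (delta |i - l|). The sum over ranks on the right is the one in
    [C_const]. *)
Lemma sum_prod_gaps_le Lam tau (delta c : R) (f : 'I_S -> 'I_S -> R) :
  0 < delta ->
  (forall j k, j \in Lam -> k \in Lam -> j != k -> delta <= `|tau j - tau k|) ->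
  (forall j k, j \in Lam -> k \in Lam -> j != k -> 0 <= f j k <= c / `|tau j - tau k|) ->
  \sum_(j in Lam) (\prod_(k in Lam :\ j) f j k) ^+ 2 <=
    (c / delta) ^+ 2 ^+ (#|Lam| - 1) *
    \sum_(1 <= j < #|Lam|.+1) \prod_(1 <= k < #|Lam|.+1 | k != j) (1 / (j%:R - k%:R) ^+ 2).
Proof.
move=> delta0 hsep hf.
have [->|[x0 _]] := set_0Vmem Lam.
  by rewrite big_set0 cards0 big_geq // mulr0.
have [s [ps gap]] := sorted_gaps hsep.
have us : uniq s by rewrite (perm_uniq ps) enum_uniq.
have sz : size s = #|Lam| by rewrite (perm_size ps) cardE.
have ms k : (k \in s) = (k \in Lam) by rewrite (perm_mem ps) mem_enum.
rewrite -sz -big_enum -(perm_big _ ps) /= big_add1 /= mulr_sumr.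
rewrite (big_nth x0) !big_mkord; apply: ler_sum => i _.
rewrite big_add1 /= big_mkord.
have -> : \prod_(k in Lam :\ nth x0 s i) f (nth x0 s i) k =
    \prod_(l < size s | l != i) f (nth x0 s i) (nth x0 s l).
  have -> : \prod_(k in Lam :\ nth x0 s i) f (nth x0 s i) k =
      \prod_(k <- s | k != nth x0 s i) f (nth x0 s i) k.
    rewrite (perm_big _ ps) /= big_enum_cond /=.
    by apply: eq_bigl => k; rewrite in_setD1 andbC.
  rewrite (big_nth x0) big_mkord; apply: eq_bigl => l.
  by rewrite nth_uniq.
have -> : (c / delta) ^+ 2 ^+ (size s - 1) = \prod_(l < size s | l != i) (c / delta) ^+ 2.
  by rewrite prodr_const (cardC1 i) card_ord subn1.
have -> : \prod_(l < size s | l.+1 != i.+1) (1 / (i.+1%:R - l.+1%:R) ^+ 2) =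
   \prod_(l < size s | l != i) (1 / (i%:R - l%:R) ^+ 2) :> R.
  apply: eq_big => [l|l _]; first by rewrite eqSS.
  by rewrite -!natr1 opprD addrACA subrr addr0.
rewrite -prodrXl -big_split /=; apply: ler_prod => l li; rewrite sqr_ge0 /=.
have il : nth x0 s i != nth x0 s l by rewrite nth_uniq // eq_sym.
have iL : nth x0 s i \in Lam by rewrite -ms mem_nth.
have lL : nth x0 s l \in Lam by rewrite -ms mem_nth.
have /andP[f0 fc] := hf _ _ iL lL il.
have d0 := lt_le_trans delta0 (hsep _ _ iL lL il).
have c0 : 0 <= c.
  by have := le_trans f0 fc; rewrite pmulr_lge0 ?invr_gt0.
have gil : delta * `|i%:R - l%:R| <= `|tau (nth x0 s i) - tau (nth x0 s l)|.
  have : (i < l)%N || (l < i)%N by rewrite -neq_ltn eq_sym.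
  case/orP => h.
    have := gap x0 _ _ h (ltn_ord l); rewrite distrC ger0_norm; last first.
      by rewrite subr_ge0 ler_nat ltnW.
    by move/le_trans; apply; rewrite distrC ler_norm.
  have := gap x0 _ _ h (ltn_ord i); rewrite ger0_norm; last first.
    by rewrite subr_ge0 ler_nat ltnW.
  by move/le_trans; apply; rewrite ler_norm.
have il0 : 0 < `|i%:R - l%:R : R|.
  by rewrite normr_gt0 subr_eq0 eqr_nat eq_sym.
rewrite mul1r -(real_normK (num_real (i%:R - l%:R))) -exprVn -exprMn.
rewrite ler_pXn2r ?nnegrE //; last by rewrite !mulr_ge0 ?invr_ge0 // ltW.
apply: le_trans fc _; rewrite -mulrA; apply: ler_wpM2l => //.
by rewrite -invfM lef_pV2 ?posrE // mulr_gt0.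
Qed.

End SortedGaps.

(** * Lagrange factors of a clump and the constant C_a *)

Section ClumpConstant.
Variable R : realType.

Lemma one_sub_pi_sqr_gt0 (lam : nat) : (1 < lam)%N ->
  0 < 1 - pi ^+ 2 / (3 * lam%:R ^+ 2) :> R.
Proof.
move=> lam1; have l2 : 2 <= lam%:R :> R by rewrite ler_nat.
have p1 := @pi_lt R; have p2 := @pi_ge2 R.
by rewrite subr_gt0 ltr_pdivrMr; nra.
Qed.

(** For lam = 1 the base may be negative, but the exponent is 0 and both sides are 1. *)
Lemma powR_halfN (lam : nat) (x : R) : (0 < lam)%N -> ((1 < lam)%N -> 0 <= x) ->
  powR x (- (lam%:R - 1) / 2) = Num.sqrt x ^- (lam - 1).
Proof.
case: lam => // -[|n] _ h; first by rewrite subrr oppr0 mul0r powRr0 expr0 invr1.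
have x0 := h isT.
rewrite -[X in _ - X]/(1%:R) -natrB // mulrC powRrM powR12_sqrt // powRN.
by rewrite powR_mulrn ?sqrtr_ge0.
Qed.

(** Puts the squared constant in the shape produced by [sum_prod_gaps_le] with spacing alpha / L;
    800/361 is the square of 20 sqrt(2) / 19. *)
Lemma C_const_sqr (lam L : nat) (alpha : R) : (0 < lam)%N ->
  (C_const R lam L * alpha ^- (lam - 1)) ^+ 2 = 800 / 361 *
  (lam%:R ^+ 2 *
   (((pi * (L %/ lam)%N%:R * Num.sqrt (1 - pi ^+ 2 / (3 * lam%:R ^+ 2)))^-1 / (alpha / L%:R))
      ^+ 2 ^+ (lam - 1) *
    \sum_(1 <= j < lam.+1) \prod_(1 <= k < lam.+1 | k != j) (1 / (j%:R - k%:R) ^+ 2))).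
Proof.
move=> lam0; have ln0 : lam%:R != 0 :> R by rewrite pnatr_eq0 -lt0n.
rewrite /C_const /B_const powR_halfN // => [|l1]; last exact/ltW/one_sub_pi_sqr_gt0.
set k := Num.sqrt (1 - _); set q := (L %/ lam)%N%:R; set s := \sum_(_ <= _ < _) _.
have s0 : 0 <= s.
  apply: sumr_ge0 => j _; apply: prodr_ge0 => i _.
  by rewrite divr_ge0 // sqr_ge0.
have -> : (pi * q * k)^-1 / (alpha / L%:R) =
    k^-1 * (L%:R / lam%:R) * q^-1 * (lam%:R / pi) * alpha^-1.
  rewrite !invfM !invrK.
  rewrite [RHS](_ : _ = (lam%:R / lam%:R) * (pi^-1 / q / k * (alpha^-1 * L%:R))).
    by rewrite divff // mul1r.
  by ring.
rewrite -!exprVn.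
rewrite -exprM mulnC exprM !exprMn.
rewrite (sqr_sqrtr s0) (sqr_sqrtr (ler0n _ _)).
by field.
Qed.

Variables (S : nat) (omega : 'I_S -> R).

(* Membership in a common short arc allows lifting the nodes of a clump to the
   line, where Q = floor(L / lambda) times any gap stays below 1 / lambda. *)
Lemma clump_lift (L : nat) (alpha : R) (Lam : {set 'I_S}) :
  (exists t : R, forall j, j \in Lam -> in_open_arc t (L%:R^-1) (omega j)) ->
  (forall j k, j != k -> alpha / L%:R <= Tnorm (omega j - omega k)) ->
  exists tau : 'I_S -> R, 
   [/\ forall Q j k, circle (Q%:R * omega j) - circle (Q%:R * omega k) =
          circle (Q%:R * tau j) - circle (Q%:R * tau k),
       forall j k, j \in Lam -> k \in Lam -> `|tau j - tau k| <= L%:R^-1 &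
       forall j k, j != k -> alpha / L%:R <= `|tau j - tau k|].
Proof.
move=> [t ht] hsep.
have /choice[n hn] : forall j, exists n : int, j \in Lam ->
    t < omega j + n%:~R < t + L%:R^-1.
  move=> j; case: (boolP (j \in Lam)) => jL; last by exists 0.
  by have [n hn] := ht j jL; exists n.
exists (fun j => omega j + (n j)%:~R); split.
- move=> Q j k.
  have e i : circle (Q%:R * (omega i + (n i)%:~R)) = circle (Q%:R * omega i).
    rewrite mulrDr -(circleD_int (Q%:R * omega i) (Q%:Z * n i)) intrM.
    by [].
  by rewrite !e.
- move=> j k jL kL; have /andP[j1 j2] := hn j jL; have /andP[k1 k2] := hn k kL.
  by rewrite ler_norml; apply/andP; split; lra.
- move=> j k jk; apply: le_trans (hsep j k jk) _.
  apply: le_trans (Tnorm_le _ (n k - n j)) _; rewrite intrB.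
  by rewrite le_eqVlt; apply/orP; left; apply/eqP; congr (`| _ |); ring.
Qed.

(** A Lagrange factor is 1 / |sin(pi u)| with u = Q |tau j - tau k| <= 1 / lambda. The crude bound
    |sin(pi u)| >= u suffices for the values at other clumps; the sharper [sin_pi_sqr_ge], fed into
    [sum_prod_gaps_le], reproduces [C_const]. *)
Lemma clump_factors (L : nat) (alpha : R) (Lam : {set 'I_S}) :
  (0 < L)%N -> 0 < alpha ->
  (exists t : R, forall j, j \in Lam -> in_open_arc t (L%:R^-1) (omega j)) ->
  (forall j k, j != k -> alpha / L%:R <= Tnorm (omega j - omega k)) ->
  (0 < #|Lam| <= L)%N ->
  let Q := (L %/ #|Lam|)%N in
  [/\ forall j k, j \in Lam -> k \in Lam -> j != k ->
        circle (Q%:R * omega j) != circle (Q%:R * omega k),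
      forall j k, j \in Lam -> k \in Lam -> j != k ->
        lagrange_factor omega Q j k <= 2 * #|Lam|%:R / alpha &
      800 / 361 * (#|Lam|%:R ^+ 2 *
        \sum_(j in Lam) (\prod_(k in Lam :\ j) lagrange_factor omega Q j k) ^+ 2)
      <= (C_const R #|Lam| L * alpha ^- (#|Lam| - 1)) ^+ 2].
Proof.
move=> L0 alpha0 harc hsep /andP[lam0 lamL] Q.
have [tau [tauE tau_le tau_ge]] := clump_lift harc hsep.
have LR : 0 < L%:R :> R by rewrite ltr0n.
have Q0 : (0 < Q)%N by rewrite divn_gt0.
have QR : 0 < Q%:R :> R by rewrite ltr0n.
have lR : 0 < #|Lam|%:R :> R by rewrite ltr0n.
have d0 j k : j != k -> 0 < `|tau j - tau k|.
  by move=> jk; apply: lt_le_trans (tau_ge _ _ jk); rewrite divr_gt0.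
have lam2 j k : j \in Lam -> k \in Lam -> j != k -> (1 < #|Lam|)%N.
  by move=> jL kL jk; apply/card_gt1P; exists j, k; split.
have u_le j k : j \in Lam -> k \in Lam -> Q%:R * `|tau j - tau k| <= #|Lam|%:R^-1.
  move=> jL kL; rewrite mulrC -ler_pdivlMr // -invfM -natrM.
  apply: le_trans (tau_le _ _ jL kL) _.
  by rewrite lef_pV2 ?posrE ?ltr0n ?muln_gt0 ?lam0 // ler_nat mulnC leq_trunc_div.
have half j k : j \in Lam -> k \in Lam -> j != k -> #|Lam|%:R^-1 <= 1 / 2 :> R.
  move=> jL kL jk; rewrite mul1r lef_pV2 ?posrE // ler_nat; exact: lam2 jk.
have nrm j k : normc (circle (Q%:R * omega j) - circle (Q%:R * omega k)) =
    2 * `|sin (pi * (Q%:R * `|tau j - tau k|))|.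
  rewrite tauE normc_circleB -mulrBr; congr (2 * _).
  case: (ger0P (tau j - tau k)) => // _.
  by rewrite !mulrN sinN normrN.
have sin_ge j k : j \in Lam -> k \in Lam -> j != k ->
    Q%:R * `|tau j - tau k| <= `|sin (pi * (Q%:R * `|tau j - tau k|))|.
  move=> jL kL jk; apply: le_trans (ler_norm _); apply: sin_pi_ge.
  apply/andP; split; last exact: le_trans (u_le _ _ jL kL) (half _ _ jL kL jk).
  by rewrite mulr_ge0 ?normr_ge0 ?ler0n.
have sin_gt j k : j \in Lam -> k \in Lam -> j != k ->
    0 < `|sin (pi * (Q%:R * `|tau j - tau k|))|.
  move=> jL kL jk; apply: lt_le_trans (sin_ge _ _ jL kL jk).
  by rewrite mulr_gt0 // d0.
have fE j k : lagrange_factor omega Q j k =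
    `|sin (pi * (Q%:R * `|tau j - tau k|))|^-1.
  by rewrite /lagrange_factor nrm invfM mulrA divff ?mul1r.
split.
- move=> j k jL kL jk; rewrite -subr_eq0 -normc_eq0 nrm mulf_neq0 //.
  by rewrite gt_eqF // sin_gt.
- move=> j k jL kL jk; rewrite fE.
  have h : (Q%:R * `|tau j - tau k|)^-1 <= 2 * #|Lam|%:R / alpha.
    rewrite -[leRHS]invrK lef_pV2 ?posrE ?invr_gt0 ?divr_gt0 ?mulr_gt0 ?d0 //.
    rewrite invf_div; apply: (@le_trans _ _ (Q%:R * (alpha / L%:R))).
      rewrite [leRHS]mulrCA; apply: ler_wpM2l; first exact: ltW.
      rewrite ler_pdivlMr // mulrC.
      rewrite ler_pdivrMr ?mulr_gt0 // -!natrM ler_nat.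
      (* L < (Q + 1) lambda <= 2 Q lambda, as Q >= 1. *)
      have := ltn_ceil L lam0; rewrite -/Q; move: (#|Lam|) Q0 => l; nia.
    by apply: ler_wpM2l; [exact: ltW|exact: tau_ge].
  by apply: le_trans h; rewrite lef_pV2 ?posrE ?mulr_gt0 ?d0 ?sin_gt ?sin_ge.
- rewrite C_const_sqr //.
  apply: ler_wpM2l; first by rewrite divr_ge0 ?ler0n.
  apply: ler_wpM2l; first exact: sqr_ge0.
  apply: (sum_prod_gaps_le (tau := tau)); first by rewrite divr_gt0.
    by move=> j k _ _ jk; exact: tau_ge.
  move=> j k jL kL jk; rewrite fE invr_ge0 normr_ge0 /=.
  have l2 := lam2 _ _ jL kL jk.
  set kap := 1 - _; have kap0 : 0 < kap by exact: one_sub_pi_sqr_gt0.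
  have sk0 : 0 < Num.sqrt kap by rewrite sqrtr_gt0.
  rewrite -invfM lef_pV2 ?posrE ?mulr_gt0 ?pi_gt0 ?d0 ?sin_gt //.
  rewrite -[leLHS]ger0_norm; last by rewrite !mulr_ge0 ?normr_ge0 ?sqrtr_ge0 ?ler0n ?pi_ge0.
  rewrite -ler_sqr ?qualifE /= ?normr_ge0 // !real_normK ?num_real //.
  apply: le_trans (@sin_pi_sqr_ge R #|Lam| (Q%:R * `|tau j - tau k|) l2 _).
    rewrite -/kap -[X in _ <= _ * X](sqr_sqrtr (ltW kap0)).
    by rewrite -exprMn mulrAC !mulrA lexx.
  by rewrite u_le // mulr_ge0 ?normr_ge0 ?ler0n.
Qed.

End ClumpConstant.

(** * Well separated nodes *)

Section WellSeparatedNodes.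
Variable R : realType.

Lemma sum_shift_le (a : nat -> R) (p N K : nat) : (forall m, 0 <= a m) ->
  (p + N <= K)%N -> \sum_(q < N) a (p + q)%N <= \sum_(m < K) a m.
Proof.
move=> a0 h; rewrite -(big_mkord xpredT a) (big_cat_nat (n := p)) //=; last by lia.
rewrite [X in _ + X](big_cat_nat (n := (p + N)%N)) //=; last by lia.
have -> : \sum_(p <= i < p + N) a i = \sum_(q < N) a (p + q)%N.
  rewrite -{1}[p]add0n big_addn addKn big_mkord.
  by apply: eq_bigr => i _; rewrite addnC.
rewrite addrCA lerDl addr_ge0 //; apply: sumr_ge0 => i _; exact: a0.
Qed.

(* The term b = 0 is 0, as 0^-1 = 0. *)
Lemma sum_inv_sqr_le (n : nat) : \sum_(b < n) (b%:R^-1 : R) ^+ 2 <= 2.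
Proof.
(* The strengthened bound is inductive because 1 / (x + 1)^2 <= 1 / x - 1 / (x + 1). *)
suff h m : \sum_(b < m.+2) (b%:R^-1 : R) ^+ 2 <= 2 - m.+1%:R^-1.
  case: n => [|[|m]]; first by rewrite big_ord0.
    by rewrite big_ord1 invr0 expr0n.
  by apply: le_trans (h m) _; rewrite lerBlDr lerDl invr_ge0.
elim: m => [|m IH].
  by rewrite 2!big_ord_recr big_ord0 /= invr0 !invr1; lra.
rewrite big_ord_recr /=; move: IH; set s := \sum_(_ < _) _.
rewrite -[m.+2%:R]natr1; have : 0 < m.+1%:R :> R by rewrite ltr0n.
move: m.+1%:R => x x0 IH; have x1 : x + 1 != 0 by lra.
have : (x + 1)^-1 ^+ 2 + (x + 1)^-1 <= x^-1.
  rewrite -subr_ge0.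
  have -> : x^-1 - ((x + 1)^-1 ^+ 2 + (x + 1)^-1) = x^-1 * (x + 1)^-1 ^+ 2.
    by field; rewrite x1 /=; lra.
  by rewrite mulr_ge0 ?sqr_ge0 // invr_ge0 ltW.
by move: IH; set u := (x + 1)^-1; set w := x^-1; lra.
Qed.

Variables (S : nat) (omega : 'I_S -> R).

(** Each difference to [omega j] is lifted to [d k] in [-1/2, 1/2] and filed under its sign and the
    integer part [b k] of |d k| / delta. Separation makes the filing injective, so up to the factor
    1 / delta^2 the sum is at most two copies of the sum of 1 / b^2. *)
Lemma sum_inv_dist_sqr_le (delta : R) (j : 'I_S) : 0 < delta ->
  (forall k l, k != l -> delta <= Tnorm (omega k - omega l)) ->
  \sum_(k | k != j) 4 / normc (circle (omega k) - circle (omega j)) ^+ 2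
    <= 4 / delta ^+ 2.
Proof.
move=> delta0 hsep.
have /choice[n hn] : forall k, exists n : int, `|omega k - omega j - n%:~R| <= 1 / 2.
  by move=> k; exact: nearest_int.
pose d k := omega k - omega j - (n k)%:~R.
pose b k := Num.truncn (`|d k| / delta).
have bP k : (b k)%:R <= `|d k| / delta < (b k).+1%:R.
  by apply: truncn_itv; rewrite divr_ge0 // ltW.
have d_le k : `|d k| <= 1 / 2 by exact: hn.
have d_ge k : k != j -> delta <= `|d k|.
  by move=> kj; apply: le_trans (hsep _ _ kj) _; exact: Tnorm_le.
have d_sep k l : k != l -> delta <= `|d k - d l|.
  move=> kl; apply: le_trans (hsep _ _ kl) _.
  apply: le_trans (Tnorm_le _ (n k - n l)) _; rewrite intrB.
  by rewrite le_eqVlt; apply/orP; left; apply/eqP; congr (`| _ |); rewrite /d; ring.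
pose N := (\max_k b k).+1.
have bN k : (b k < N)%N by rewrite ltnS leq_bigmax.
pose h k : bool * 'I_N := (0 <= d k, Ordinal (bN k)).
have h_inj : {in [set k | k != j] &, injective h}.
  move=> k l _ _ [es eb]; apply/eqP/negPn/negP => kl.
  have := d_sep _ _ kl.
  have /andP[] := bP k; have /andP[] := bP l; rewrite eb.
  rewrite -natr1 !ler_pdivlMr // !ltr_pdivrMr //.
  move: (b l)%:R es => c es.
  case: (ger0P (d k)) es => dk; case: (ger0P (d l)) => dl // _ h1 h2 h3 h4;
    rewrite leNgt ltr_norml; apply/negP/negPn/andP; split; nra.
pose F (x : bool * 'I_N) : R := (x.2%:R^-1) ^+ 2.
apply: (@le_trans _ _ (\sum_(k in [set k | k != j]) F (h k) / delta ^+ 2)).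
  rewrite [leLHS](eq_bigl (fun k => k \in [set k | k != j])); last first.
    by move=> k; rewrite inE.
  apply: ler_sum => k; rewrite inE => kj.
  have dk0 : 0 < `|d k| by apply: lt_le_trans (d_ge _ kj).
  have nd : 2 * `|d k| <= normc (circle (omega k) - circle (omega j)).
    exact: circle_dist_ge.
  (* Since |d k| >= delta, the index b k = 0, whose term in [F] is only the default value 0, does
     not occur. *)
  have b0 : 0 < (b k)%:R :> R.
    rewrite ltr0n lt0n; apply/eqP => b0.
    by have /andP[_] := bP k; rewrite b0 ltr_pdivrMr // mul1r ltNge d_ge.
  have /andP[hb _] := bP k; rewrite ler_pdivlMr // in hb.
  apply: (@le_trans _ _ (4 / (2 * `|d k|) ^+ 2)).
    apply: ler_wpM2l => //; rewrite lef_pV2 ?posrE ?exprn_gt0 ?mulr_gt0 //.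
      by rewrite ler_pXn2r ?nnegrE ?normc_ge0 ?mulr_ge0.
    by apply: lt_le_trans nd; rewrite mulr_gt0.
  rewrite exprMn invfM mulrA (_ : 4 / 2 ^+ 2 = 1); last by field.
  rewrite mul1r /F /= -exprVn -exprVn -exprMn -invfM exprVn exprVn.
  rewrite lef_pV2 ?posrE ?exprn_gt0 ?mulr_gt0 //.
  by rewrite ler_pXn2r ?nnegrE // mulr_ge0 // ltW.
rewrite -mulr_suml; apply: ler_wpM2r; first by rewrite invr_ge0 sqr_ge0.
rewrite -(big_imset F h_inj) /=.
apply: (@le_trans _ _ (\sum_x F x)).
  rewrite [leRHS](bigID (mem (h @: [set k | k != j]))) /= lerDl.
  by apply: sumr_ge0 => x _; exact: sqr_ge0.
rewrite -(pair_bigA _ (fun s b => F (s, b))) /= big_bool /=.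
by rewrite /F /=; have := sum_inv_sqr_le N; lra.
Qed.

(** Summing |y(p + q)|^2 over p, q < N gives a quadratic form with the Fejer-type kernel
    [D j k ^+ 2], equal to N^2 on the diagonal. Its off-diagonal row sums are at most B = L^2 / 16,
    so the form is at least N^2 - B. *)
Lemma separated_lower_bound (L : nat) (v : 'I_S -> R[i]) : (0 < L)%N ->
  (forall j k, j != k -> 8 / L%:R <= Tnorm (omega j - omega k)) ->
  3 / 8 * L.+1%:R * (\sum_j normc (v j) ^+ 2) <=
    \sum_(m < L.+1) normc (\sum_k circle (omega k) ^+ m * v k) ^+ 2.
Proof.
move=> L0 hsep; have LR : 0 < L%:R :> R by rewrite ltr0n.
set V := \sum_j _; set Y := \sum_(m < _) _.
have V0 : 0 <= V by apply: sumr_ge0 => i _; exact: sqr_ge0.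
pose z k := circle (omega k).
pose y (m : nat) := \sum_k z k ^+ m * v k.
(* With p, q < N the index p + q stays at most L. *)
pose N := (L./2).+1.
pose B : R := 4 / (8 / L%:R) ^+ 2.
pose D j k := \sum_(p < N) (z j * (z k)^*) ^+ p.
have hW : \sum_(p < N) \sum_(q < N) normc (y (p + q)%N) ^+ 2 <= N%:R * Y.
  rewrite mulr_natl -[in leRHS](card_ord N) -sumr_const.
  apply: ler_sum => p _.
  apply: (@sum_shift_le (fun m => normc (y m) ^+ 2)) => [m|].
    exact: sqr_ge0.
  by have := ltn_ord p; rewrite /N; lia.
have hG : ((\sum_(p < N) \sum_(q < N) normc (y (p + q)%N) ^+ 2)%:C)%C =
    \sum_j \sum_k v j * (v k)^* * D j k ^+ 2.
  rewrite rmorph_sum /=.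
  transitivity (\sum_(p < N) \sum_(q < N) \sum_j \sum_k
     (v j * (v k)^* * (z j * (z k)^*) ^+ p) * (z j * (z k)^*) ^+ q).
    apply: eq_bigr => p _; rewrite rmorph_sum /=; apply: eq_bigr => q _.
    rewrite normc_sqr rmorph_sum mulr_suml; apply: eq_bigr => j _.
    rewrite mulr_sumr; apply: eq_bigr => k _.
    by rewrite -[in RHS]mulrA -exprD exprMn rmorphM rmorphXn /=; ring.
  pose t j k (p q : 'I_N) := v j * (v k)^* * (z j * (z k)^*) ^+ p * (z j * (z k)^*) ^+ q.
  transitivity (\sum_(p < N) \sum_j \sum_(q < N) \sum_k t j k p q).
    by apply: eq_bigr => p _; exact: exchange_big.
  rewrite exchange_big /=; apply: eq_bigr => j _.
  transitivity (\sum_(p < N) \sum_k \sum_(q < N) t j k p q).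
    by apply: eq_bigr => p _; exact: exchange_big.
  rewrite exchange_big /=; apply: eq_bigr => k _; rewrite /t.
  rewrite expr2 mulrA mulr_sumr exchange_big; apply: eq_bigr => q _.
  by rewrite mulr_sumr mulr_suml.
have Djj j : D j j = N%:R.
  rewrite /D -normc_sqr normc_circle expr1n.
  under eq_bigr do rewrite expr1n.
  by rewrite sumr_const card_ord.
have zz k l : k != l -> 0 < normc (z k - z l).
  move=> kl; apply: lt_le_trans (Tnorm_circle _ _).
  by rewrite mulr_gt0 //; apply: lt_le_trans (hsep _ _ kl); rewrite divr_gt0.
have Djk j k : j != k -> normc (D j k) ^+ 2 <= 4 / normc (z k - z j) ^+ 2.
  move=> jk; rewrite ler_pdivlMr ?exprn_gt0 ?zz // 1?eq_sym // -exprMn.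
  rewrite (_ : 4 = 2 ^+ 2); last by ring.
  rewrite ler_pXn2r ?nnegrE ?mulr_ge0 ?normc_ge0 //.
  have -> : normc (z k - z j) = normc (z j * (z k)^* - 1).
    rewrite normcB_sym -[LHS]mulr1 -(normc_circle (- omega k)) -normcM mulrBl.
    by rewrite circleN -normc_sqr normc_circle expr1n.
  rewrite -normcM mulrC -subrX1; apply: le_trans (normcD_le _ _) _.
  by rewrite normcX normcM normc_conj !normc_circle mulr1 expr1n normcN normc1.
pose O := \sum_j \sum_(k | k != j) v j * (v k)^* * D j k ^+ 2.
have split_G : \sum_j \sum_k v j * (v k)^* * D j k ^+ 2 =
    ((N%:R ^+ 2 * V)%:C)%C + O.
  rewrite rmorphM rmorph_sum mulr_sumr -big_split; apply: eq_bigr => j _ /=.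
  by rewrite (bigD1 j) //= Djj normc_sqr mulrC rmorphXn /= rmorph_nat.
have hO : normc O <= B * V.
  apply: le_trans (normc_sum_le _ _ _) _.
  pose b j k := 4 / normc (z k - z j) ^+ 2.
  have b0 j k : 0 <= b j k by rewrite divr_ge0 ?sqr_ge0.
  have hb j : \sum_(k | k != j) b j k <= B.
    by apply: sum_inv_dist_sqr_le => //; rewrite divr_gt0.
  (* By the arithmetic-geometric mean inequality and the symmetry of b, both halves reduce to row
     sums. *)
  apply: (@le_trans _ _ (\sum_j \sum_(k | k != j)
      (normc (v j) ^+ 2 * b j k / 2 + normc (v k) ^+ 2 * b j k / 2))).
    apply: ler_sum => j _; apply: le_trans (normc_sum_le _ _ _) _.
    apply: ler_sum => k kj; rewrite (normcM (v j * _)) (normcM (v j)) normcX normc_conj.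
    apply: (@le_trans _ _ (normc (v j) * normc (v k) * b j k)).
      by apply: ler_wpM2l; rewrite ?mulr_ge0 ?normc_ge0 ?Djk // eq_sym.
    rewrite -subr_ge0.
    move: (normc (v j)) (normc (v k)) (b j k) (b0 j k) => a c e e0.
    rewrite (_ : _ - _ = (a - c) ^+ 2 * e / 2); last by field.
    by rewrite divr_ge0 // mulr_ge0 // sqr_ge0.
  under eq_bigr => j _ do rewrite big_split /=.
  rewrite big_split /= [X in _ + X](exchange_big_dep xpredT) //=.
  have e1 : \sum_i \sum_(i0 | i0 != i) normc (v i) ^+ 2 * b i i0 / 2 <= B * V / 2.
    rewrite /V mulr_sumr mulr_suml; apply: ler_sum => j _.
    rewrite -mulr_suml -mulr_sumr [B * _]mulrC; apply: ler_wpM2r => //.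
    by apply: ler_wpM2l; [exact: sqr_ge0|exact: hb].
  have e2 : \sum_j \sum_(i | j != i) normc (v j) ^+ 2 * b i j / 2 <= B * V / 2.
    apply: le_trans e1; apply: ler_sum => j _.
    rewrite le_eqVlt; apply/orP; left; apply/eqP; apply: eq_big => i.
      by rewrite eq_sym.
    by move=> _; rewrite /b normcB_sym.
  by move: e1 e2; lra.
have h : N%:R ^+ 2 * V <= N%:R * Y + B * V.
  apply: le_trans (lerD hW hO).
  rewrite -[X in X + _]ger0_norm; last first.
    by do 2!apply: sumr_ge0 => ? _; exact: sqr_ge0.
  rewrite -normc_real hG split_G -(normcN O); apply: le_trans (normcD_le _ _).
  by rewrite addrK normc_real ler_norm.
have NL : L.+1%:R / 2 <= N%:R :> R.
  by rewrite ler_pdivrMr // -natrM ler_nat /N; lia.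
have N0 : 0 < N%:R :> R by rewrite ltr0n.
have BE : B = L%:R ^+ 2 / 16 by rewrite /B; field; rewrite gt_eqF.
(* From N >= (L + 1) / 2 follows B <= N^2 / 4, hence N^2 - B >= 3 N^2 / 4 >= 3 N (L + 1) / 8. *)
rewrite -(ler_pM2l N0); apply: le_trans (_ : N%:R ^+ 2 * V - B * V <= _); last by lra.
rewrite -mulrBl mulrA; apply: ler_wpM2r => //; rewrite BE.
move: NL; rewrite -natr1; move: N%:R L%:R LR => a l l0 al; nra.
Qed.

End WellSeparatedNodes.

(** * Smallest singular value for clumps *)

Section VandermondeClumps.
Variable R : realType.

Lemma beta_sqr_ge (S lam : nat) (alpha beta : R) : 0 < alpha -> 0 < beta ->
  20 * powR S%:R (1 / 2) * powR lam%:R (5 / 2) / powR alpha (1 / 2) <= beta ->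
  400 * S%:R * lam%:R ^+ 5 / alpha <= beta ^+ 2.
Proof.
move=> a0 b0 h.
have h0 : 0 <= 20 * powR S%:R (1 / 2) * powR lam%:R (5 / 2) / powR alpha (1 / 2).
  by rewrite divr_ge0 ?mulr_ge0 ?powR_ge0.
have : (20 * powR S%:R (1 / 2) * powR lam%:R (5 / 2) / powR alpha (1 / 2)) ^+ 2 <= beta ^+ 2.
  by rewrite ler_pXn2r // nnegrE ltW.
have sq (x r : R) : (powR x r) ^+ 2 = powR x (r * 2).
  by rewrite powRrM powR_mulrn ?powR_ge0.
rewrite !exprMn exprVn !sq.
rewrite !divfK ?pnatr_eq0 // !powRr1 ?ler0n ?(ltW a0) // powR_mulrn ?ler0n //.
by congr (_ <= _); ring.
Qed.

(** The bound on beta gives u^2 <= rho = alpha / (100 S lambda) for the kernel bound u. Of the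
    lambda factors u^2, all but one absorb the Lagrange factors, as 2 lambda rho / alpha = 1 / (50
    S) <= 1; the last one leaves S rho <= 1/100, by alpha <= 1. *)
Lemma far_value_le (S lam L P : nat) (alpha beta g : R) :
  (0 < S)%N -> (0 < lam)%N -> (0 < L)%N -> 0 < alpha -> alpha <= 1 -> 0 < beta ->
  400 * S%:R * lam%:R ^+ 5 / alpha <= beta ^+ 2 ->
  0 <= g -> g <= (2 * lam%:R / alpha) ^+ (lam - 1) ->
  (L <= P.+1 * (2 * lam ^ 2))%N ->
  S%:R * (g * (2 / (2 * (beta / L%:R) * P.+1%:R)) ^+ (2 * lam)) <= 1 / 100.
Proof.
move=> S0 l0 L0 a0 a1 b0 hb g0 hg hP.
have SR : 1 <= S%:R :> R by rewrite ler1n.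
have lR : 1 <= lam%:R :> R by rewrite ler1n.
have LR : 0 < L%:R :> R by rewrite ltr0n.
have PR : 0 < P.+1%:R :> R by rewrite ltr0n.
have hPR : L%:R <= P.+1%:R * (2 * lam%:R ^+ 2) :> R.
  by rewrite -natrX -!natrM ler_nat.
set u := 2 / _; pose rho : R := alpha / (100 * S%:R * lam%:R).
have S0R : 0 < S%:R :> R by lra.
have l0R : 0 < lam%:R :> R by lra.
have rho0 : 0 < rho by rewrite divr_gt0 ?mulr_gt0.
have u0 : 0 <= u by rewrite divr_ge0 // ?mulr_ge0 ?divr_ge0 // ltW.
have hu : u <= 2 * lam%:R ^+ 2 / beta.
  rewrite /u ler_pdivrMr; last by rewrite !mulr_gt0 ?invr_gt0.
  rewrite [leRHS](_ : _ = (P.+1%:R * (2 * lam%:R ^+ 2)) / L%:R * 2); last first.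
    by field; rewrite !gt_eqF.
  by rewrite ler_peMl // ler_pdivlMr // mul1r.
have hu2 : u ^+ 2 <= rho.
  apply: (@le_trans _ _ ((2 * lam%:R ^+ 2 / beta) ^+ 2)).
    apply: lerXn2r; [exact: u0| |exact: hu].
    by rewrite nnegrE !mulr_ge0 ?invr_ge0 ?exprn_ge0 ?ler0n ?(ltW b0).
  rewrite exprMn exprVn ler_pdivrMr ?exprn_gt0 //.
  apply: le_trans (_ : rho * (400 * S%:R * lam%:R ^+ 5 / alpha) <= _).
    rewrite le_eqVlt; apply/orP; left; apply/eqP; rewrite /rho; field.
    by rewrite !gt_eqF.
  by apply: ler_wpM2l => //; exact: ltW.
have h1 : g * u ^+ (2 * lam) <= rho.
  rewrite exprM; apply: (@le_trans _ _ ((2 * lam%:R / alpha) ^+ (lam - 1) * rho ^+ lam)).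
    by apply: ler_pM => //; rewrite ?exprn_ge0 ?sqr_ge0 // ler_pXn2r ?nnegrE ?sqr_ge0 // ltW.
  rewrite -[X in rho ^+ X](subnK l0) exprD expr1 mulrA -exprMn.
  rewrite -[leRHS]mul1r; apply: ler_wpM2r; first exact: ltW.
  have -> : 2 * lam%:R / alpha * rho = (50 * S%:R)^-1.
    by rewrite /rho; field; rewrite !gt_eqF.
  apply: exprn_ile1; first by rewrite invr_ge0 mulr_ge0.
  by rewrite invf_le1 ?mulr_gt0 //; lra.
apply: (@le_trans _ _ (S%:R * rho)); first by apply: ler_wpM2l.
rewrite /rho mulrA ler_pdivrMr ?mulr_gt0 //; nra.
Qed.

Variables (A S L : nat) (alpha beta : R) (omega : 'I_S -> R) (Lambda : 'I_A -> {set 'I_S}).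
Hypotheses (hL : (0 < L)%N) (hSL : (S <= L)%N).
Hypotheses (alpha0 : 0 < alpha) (beta0 : 0 < beta).
Hypothesis hclumps : clumps_model L beta alpha omega Lambda.

Local Notation c2 a := ((C_const R #|Lambda a| L * alpha ^- (#|Lambda a| - 1) : R) ^+ 2).

Lemma clump_index : exists cl : 'I_S -> 'I_A, forall a j, (j \in Lambda a) = (cl j == a).
Proof.
have /choice[cl hcl] := clumps_cover hclumps.
exists cl => a j; apply/idP/eqP => [ja|<-//].
apply/eqP/negPn/negP => ne; have := clumps_disjoint hclumps ne.
by move/disjointFr => /(_ j (hcl j)); rewrite ja.
Qed.

Lemma clump_card a : (0 < #|Lambda a| <= S)%N.
Proof.
rewrite card_gt0 (clumps_nonempty hclumps) /=.
by rewrite -[X in (_ <= X)%N]card_ord max_card.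
Qed.

(** The kernel parameters, the coefficient weight [w] and the error [eps] stay free, so that a
    single clump (no far nodes, eps = 0) and several clumps share one argument. The factor 361/800
    undoes the constant of [clump_factors]. *)
Lemma clumps_interpolation (P n : 'I_A -> nat) (w eps : R) (v : 'I_S -> R[i]) :
  0 <= w -> 0 <= eps -> eps <= 1 ->
  (forall a, 0 < n a)%N ->
  (forall a, (L %/ #|Lambda a|) * (#|Lambda a| - 1) + n a * P a <= L)%N ->
  (forall a, (P a).+1%:R^-1 <= w * #|Lambda a|%:R ^+ 2) ->
  ((1 < A)%N -> forall a g, 0 <= g -> g <= (2 * #|Lambda a|%:R / alpha) ^+ (#|Lambda a| - 1) ->
     S%:R * (g * (2 / (2 * (beta / L%:R) * (P a).+1%:R)) ^+ (n a)) <= eps) ->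
  (1 - eps) ^+ 2 * (\sum_j normc (v j) ^+ 2) <=
    w * (361 / 800) * (\sum_a c2 a) *
    \sum_(m < L.+1) normc (\sum_k circle (omega k) ^+ m * v k) ^+ 2.
Proof.
move=> w0 eps0 eps1 n0 hdeg hP hfar.
have [cl hcl] := clump_index.
pose Q a := (L %/ #|Lambda a|)%N.
have Q0 a : (0 < Q a)%N.
  by have /andP[l0 lS] := clump_card a; rewrite divn_gt0 // (leq_trans lS).
have jcl j : j \in Lambda (cl j) by rewrite hcl.
have cardL a : (0 < #|Lambda a| <= L)%N.
  by have /andP[l0 lS] := clump_card a; rewrite l0 (leq_trans lS).
have fact a := clump_factors hL alpha0 (clumps_arc hclumps a)
  (clumps_min_sep hclumps) (cardL a).
pose g j : R := \prod_(k in Lambda (cl j) :\ j) lagrange_factor omega (Q (cl j)) j k.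
have g0 j : 0 <= g j.
  by apply: prodr_ge0 => k _; rewrite divr_ge0 ?normc_ge0.
have hg j : g j <= (2 * #|Lambda (cl j)|%:R / alpha) ^+ (#|Lambda (cl j)| - 1).
  have -> : (#|Lambda (cl j)| - 1)%N = #|Lambda (cl j) :\ j|.
    by rewrite (cardsD1 j (Lambda (cl j))) jcl addKn.
  rewrite -prodr_const; apply: ler_prod => k; rewrite in_setD1 => /andP[kj kL].
  rewrite divr_ge0 ?normc_ge0 //=.
  by have [_ h _] := fact (cl j); apply: h => //; rewrite eq_sym.
have /choice[p hp] : forall j, exists p : {poly R[i]},
  [/\ (size p <= L.+1)%N, p.[circle (omega j)] = 1,
      forall k, k \in Lambda (cl j) -> k != j -> p.[circle (omega k)] = 0,
      forall w t, 0 < t -> t <= normc (circle w - circle (omega j)) ->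
        normc p.[circle w] <= g j * (2 / (t * (P (cl j)).+1%:R)) ^+ n (cl j) &
      \sum_(i < L.+1) normc p`_i ^+ 2 <= g j ^+ 2 / (P (cl j)).+1%:R].
  move=> j; apply: clump_polynomial => //; first exact: hdeg.
  by move=> k kL kj; have [h _ _] := fact (cl j); apply: h; rewrite // eq_sym.
apply: (@vandermonde_lower_bound R S L.+1 (fun k => circle (omega k)) v p) => //.
- by move=> j; have [] := hp j.
- move=> j k; have [_ p1 p0 pfar _] := hp j.
  have [<-|jk] := eqVneq j k; first by rewrite /= p1 subrr normc0 mulr0.
  rewrite subr0; have [e|ne] := eqVneq (cl j) (cl k).
    by rewrite p0 ?normc0 ?mulr0 // 1?eq_sym // hcl e.
  have A1 : (1 < A)%N.
    have : (1 < #|{: 'I_A}|)%N by apply/card_gt1P; exists (cl j), (cl k).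
    by rewrite card_ord.
  apply: le_trans (hfar A1 (cl j) (g j) (g0 j) (hg j)).
  apply: ler_wpM2l => //; apply: pfar.
    by rewrite mulr_gt0 // divr_gt0 // ltr0n.
  apply: le_trans (Tnorm_circle _ _); rewrite ler_pM2l //.
  by apply: (clumps_sep hclumps A1 (a := cl k) (b := cl j)); rewrite // eq_sym.
- apply: (@le_trans _ _ (\sum_j w * (#|Lambda (cl j)|%:R ^+ 2 * g j ^+ 2))).
    apply: ler_sum => j _; have [_ _ _ _ h] := hp j; apply: le_trans h _.
    by rewrite mulrA mulrC; apply: ler_wpM2r; rewrite ?sqr_ge0.
  rewrite -mulr_sumr -[leRHS]mulrA; apply: ler_wpM2l => //.
  rewrite (partition_big cl xpredT) //= mulr_sumr; apply: ler_sum => a _.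
  have [_ _ h] := fact a.
  rewrite (eq_bigl (mem (Lambda a))) => [|j]; last by rewrite /= hcl.
  have e : \sum_(j in Lambda a) #|Lambda (cl j)|%:R ^+ 2 * g j ^+ 2 =
      #|Lambda a|%:R ^+ 2 * \sum_(j in Lambda a)
        (\prod_(k in Lambda a :\ j) lagrange_factor omega (Q a) j k) ^+ 2.
    by rewrite mulr_sumr; apply: eq_bigr => j; rewrite hcl /g => /eqP ->.
  have scale (y z : R) : 800 / 361 * y <= z -> y <= 361 / 800 * z by lra.
  by apply: scale; rewrite e; exact: h.
Qed.

End VandermondeClumps.

Theorem vandermonde_clumps_lower_bound (R : realType) (A S L : nat) (alpha beta : R)
    (omega : 'I_S -> R) (Lambda : 'I_A -> {set 'I_S}) (v : 'I_S -> R[i]) :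
  (0 < A)%N -> (0 < S)%N -> (0 < L)%N -> (S <= L)%N -> 0 < alpha -> 0 < beta ->
  clumps_model L beta alpha omega Lambda ->
  (forall a, 20 * powR S%:R (1 / 2) * powR #|Lambda a|%:R (5 / 2) / powR alpha (1 / 2)
         <= beta) ->
  L.+1%:R * (\sum_j normc (v j) ^+ 2) <=
    (\sum_a (C_const R #|Lambda a| L * alpha ^- (#|Lambda a| - 1)) ^+ 2) *
    \sum_(m < L.+1) normc (\sum_k circle (omega k) ^+ m * v k) ^+ 2.
Proof.
move=> A0 S0 L0 SL alpha0 beta0 hc hb0.
have hb a := beta_sqr_ge alpha0 beta0 (hb0 a).
have LR : 0 < L%:R :> R by rewrite ltr0n.
have card a := clump_card hc a.
have interp := clumps_interpolation L0 SL alpha0 beta0 hc.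
set Sg := \sum_(a < A) _; set V := \sum_(j < S) _; set Y := \sum_(m < _) _.
have Sg0 : 0 <= Sg by apply: sumr_ge0 => a _; exact: sqr_ge0.
have V0 : 0 <= V by apply: sumr_ge0 => a _; exact: sqr_ge0.
have Y0 : 0 <= Y by apply: sumr_ge0 => a _; exact: sqr_ge0.
have [A1|A1] := leqP A 1.
  (* One clump: all the degree left by the Lagrange part goes to a single kernel, so that P + 1 >=
     (L + 1) / lambda^2. *)
  pose P a := (L - (L %/ #|Lambda a|) * (#|Lambda a| - 1))%N.
  have hPL a : ((L %/ #|Lambda a|) * (#|Lambda a| - 1) <= L)%N.
    by apply: leq_trans (leq_trunc_div L #|Lambda a|); rewrite leq_mul2l leq_subr orbT.
  have := @interp P (fun=> 1%N) L.+1%:R^-1 0 v.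
  rewrite subr0 expr1n mul1r -/V -/Y -/Sg => h.
  have {}h : V <= L.+1%:R^-1 * (361 / 800) * Sg * Y.
    apply: h => //.
    - by move=> a; rewrite mul1n subnKC.
    - move=> a; have /andP[l0 lS] := card a.
      rewrite mulrC ler_pdivlMr ?ltr0n // mulrC ler_pdivrMr ?ltr0n //.
      rewrite -natrX -natrM ler_nat /P.
      have := leq_trunc_div L #|Lambda a|; have := hPL a.
      move: (L %/ #|Lambda a|)%N l0 => q; move: #|Lambda a| => [//|l] _.
      rewrite subSS subn0 => h1 h2; nia.
    - by rewrite ltnNge A1.
  rewrite mulrC -ler_pdivlMr ?ltr0n //; apply: le_trans h _.
  rewrite (_ : _ * Y = 361 / 800 * (Sg * Y) / L.+1%:R); last by ring.
  apply: ler_wpM2r; first by rewrite invr_ge0.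
  by have := mulr_ge0 Sg0 Y0; lra.
have sepb j k a b : j \in Lambda a -> k \in Lambda b -> a != b ->
    beta / L%:R <= Tnorm (omega j - omega k).
  by move=> ja kb ab; apply: (clumps_sep hc A1 ab).
have [alpha1|alpha1] := leP alpha 1.
  (* The remaining degree, at least L / lambda, is shared by 2 lambda kernels, so that P + 1 >= L /
     (2 lambda^2). *)
  pose P a := ((L - (L %/ #|Lambda a|) * (#|Lambda a| - 1)) %/ (2 * #|Lambda a|))%N.
  have hPL a : ((L %/ #|Lambda a|) * (#|Lambda a| - 1) <= L)%N.
    by apply: leq_trans (leq_trunc_div L #|Lambda a|); rewrite leq_mul2l leq_subr orbT.
  have hP a : (L <= (P a).+1 * (2 * #|Lambda a| ^ 2))%N.
    have /andP[l0 lS] := card a; have l20 : (0 < 2 * #|Lambda a|)%N by rewrite muln_gt0.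
    have := ltn_ceil (L - (L %/ #|Lambda a|) * (#|Lambda a| - 1)) l20.
    rewrite -/(P a); move: (P a) => p.
    have := leq_trunc_div L #|Lambda a|; have := hPL a.
    move: (L %/ #|Lambda a|)%N l0 => q; move: #|Lambda a| => [//|l] _.
    rewrite subSS subn0 => h1 h2 h3; nia.
  have := @interp P (fun a => 2 * #|Lambda a|)%N (2 / L%:R) (1 / 100) v.
  rewrite -/V -/Y -/Sg => h.
  have {}h : (1 - 1 / 100) ^+ 2 * V <= 2 / L%:R * (361 / 800) * Sg * Y.
    apply: h => //.
    - lra.
    - by move=> a; rewrite muln_gt0; have /andP[->] := card a.
    - move=> a; rewrite -leq_subRL // mulnC; exact: leq_trunc_div.
    - move=> a; rewrite -mulrA mulrCA ler_pdivlMl // ler_pdivrMr ?ltr0n //.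
      rewrite mulrC -natrX -!natrM ler_nat; exact: hP.
    - move=> _ a g g0 hg; have /andP[l0 _] := card a.
      exact: (far_value_le S0 l0 L0 alpha0 alpha1 beta0 (hb a) g0 hg (hP a)).
  (* Here beta >= 20, and beta / L <= 1/2 because distances on the torus are at most 1/2. The slack
     (361/400)(10000/9801) < 40/41 then pays for the passage from L to L + 1. *)
  have L40 : 40 <= L%:R :> R.
    have ne : (Ordinal A0 != Ordinal A1) by [].
    have /set0Pn[j ja] := clumps_nonempty hc (Ordinal A0).
    have /set0Pn[k kb] := clumps_nonempty hc (Ordinal A1).
    have := le_trans (sepb _ _ _ _ ja kb ne) (Tnorm_le_half _).
    rewrite ler_pdivrMr // => hbL.
    have : 400 <= beta ^+ 2.
      apply: le_trans (hb (Ordinal A0)); have /andP[l0 _] := card (Ordinal A0).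
      have SR : 1 <= S%:R * #|Lambda (Ordinal A0)|%:R ^+ 5 :> R.
        by rewrite -natrX -natrM ler1n muln_gt0 S0 expn_gt0 l0.
      by rewrite ler_pdivlMr // -mulrA; lra.
    by nra.
  have h2 : V * L%:R <= (361 / 400) * (10000 / 9801) * (Sg * Y).
    move: h; rewrite (_ : 2 / L%:R * (361 / 800) * Sg * Y =
        361 / 400 * (Sg * Y) / L%:R); last first.
      by field; rewrite gt_eqF.
    rewrite ler_pdivlMr // => h; nra.
  rewrite -natr1 mulrDl mul1r [_ * V]mulrC.
  have : V * 40 <= V * L%:R by apply: ler_wpM2l.
  by have := mulr_ge0 Sg0 Y0; move: h2 L40; move: (V * L%:R) (Sg * Y) => a b; lra.
(* Now alpha > 1: the condition lambda - 1 < 1 / alpha leaves only singletons, each contributing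
   800/361 to [Sg]. *)
have card1 a : #|Lambda a| = 1%N.
  have /andP[l0 _] := card a; apply/eqP; rewrite eqn_leq l0 andbT -ltnS.
  rewrite -(ltr_nat R); have := clumps_card hc a.
  have : alpha^-1 < 1 by rewrite invf_lt1.
  by lra.
have SgE : Sg = 800 / 361 * A%:R.
  rewrite /Sg; under eq_bigr => a _.
    rewrite C_const_sqr ?card1 // big_nat1 big_nat_cond big_pred0; last first.
      by move=> i; case: i => [|[|i]].
    rewrite subnn expr0 !mulr1 expr1n mulr1.
    over.
  by rewrite sumr_const card_ord mulr_natr.
have h : 3 / 8 * L.+1%:R * V <= Y.
  apply: separated_lower_bound => // j k jk.
  have [cl hcl] := clump_index hc.
  have ne : cl j != cl k.
    apply: contra jk => /eqP e; have /eqP/cards1P[i hi] := card1 (cl j).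
    have : j \in Lambda (cl j) by rewrite hcl.
    have : k \in Lambda (cl j) by rewrite hcl e.
    by rewrite hi !inE => /eqP -> /eqP ->.
  (* If alpha < 8, then S >= 2 gives beta^2 >= 400 S / alpha > 100, and distinct nodes lie in
     different clumps. *)
  have [a8|a8] := leP 8 alpha.
    apply: le_trans (clumps_min_sep hc jk); exact: ler_wpM2r.
  apply: le_trans (sepb j k (cl j) (cl k) _ _ ne); rewrite ?hcl //.
  apply: ler_wpM2r; first by rewrite invr_ge0.
  have S2 : 2 <= S%:R :> R.
    rewrite ler_nat; have : (1 < #|{: 'I_S}|)%N by apply/card_gt1P; exists j, k.
    by rewrite card_ord.
  have := hb (cl j); rewrite card1 expr1n mulr1 ler_pdivrMr // => h.
  by nra.
have A2 : 2 <= A%:R :> R by rewrite ler_nat.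
apply: (@le_trans _ _ (8 / 3 * Y)).
  by move: h; rewrite -mulrA; lra.
by apply: ler_wpM2r => //; rewrite SgE; lra.
Qed.

(** * Euclidean and spectral norms *)

Local Open Scope sesquilinear_scope.

Section EuclideanNorm.
Variable R : realType.
Local Notation C := R[i].

Lemma adjE m n (A : 'M[C]_(m, n)) i j : A ^t* i j = (A j i)^*.
Proof. by rewrite !mxE. Qed.

Lemma adjM m n p (A : 'M[C]_(m, n)) (B : 'M[C]_(n, p)) :
  (A *m B) ^t* = B ^t* *m A ^t*.
Proof. by rewrite trmx_mul map_mxM. Qed.

Lemma adjK m n (A : 'M[C]_(m, n)) : A ^t* ^t* = A.
Proof. exact: trmxCK. Qed.

Lemma l2norm_ge0 n (v : 'cV[C]_n) : 0 <= l2norm v.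
Proof. exact: sqrtr_ge0. Qed.

Lemma l2norm_sqr n (v : 'cV[C]_n) : l2norm v ^+ 2 = \sum_i normc (v i 0) ^+ 2.
Proof. by rewrite sqr_sqrtr // sumr_ge0 // => i _; exact: sqr_ge0. Qed.

Lemma l2norm_dot n (v : 'cV[C]_n) : ((l2norm v ^+ 2)%:C)%C = (v ^t* *m v) 0 0.
Proof.
rewrite l2norm_sqr rmorph_sum mxE; apply: eq_bigr => i _ /=.
by rewrite normc_sqr adjE mulrC.
Qed.

Lemma l2norm_le n m (u : 'cV[C]_n) (v : 'cV[C]_m) :
  l2norm u ^+ 2 <= l2norm v ^+ 2 -> l2norm u <= l2norm v.
Proof. by rewrite ler_pXn2r // nnegrE l2norm_ge0. Qed.

Lemma dot_le n (u v : 'cV[C]_n) :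
  normc ((u ^t* *m v) 0 0) <= l2norm u * l2norm v.
Proof.
rewrite mxE; apply: le_trans (normc_sum_le _ _ _) _.
under eq_bigr do rewrite normcM adjE normc_conj.
by apply: sum_mul_le => i; exact: normc_ge0.
Qed.

Lemma l2norm_eq0 n (v : 'cV[C]_n) : l2norm v = 0 -> v = 0.
Proof.
move=> h; have : l2norm v ^+ 2 == 0 by rewrite h expr0n.
rewrite l2norm_sqr psumr_eq0 => [/allP h0|i _]; last exact: sqr_ge0.
apply/colP => i; have := h0 i (mem_index_enum i).
by rewrite /= sqrf_eq0 normc_eq0 mxE => /eqP.
Qed.

Lemma l2norm_gt0 n (v : 'cV[C]_n) : v != 0 -> 0 < l2norm v.
Proof.
by move=> v0; rewrite lt_def l2norm_ge0 andbT; apply: contra v0 => /eqP/l2norm_eq0->.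
Qed.

Lemma l2norm0 n : l2norm (0 : 'cV[C]_n) = 0.
Proof. by rewrite /l2norm big1 ?sqrtr0 // => i _; rewrite mxE normc0 expr0n. Qed.

Lemma l2normZ n (a : R) (v : 'cV[C]_n) : l2norm ((a%:C)%C *: v) = `|a| * l2norm v.
Proof.
rewrite /l2norm -sqrtr_sqr -sqrtrM ?sqr_ge0 //; congr Num.sqrt.
rewrite mulr_sumr; apply: eq_bigr => i _.
by rewrite mxE normcM normc_real exprMn real_normK ?num_real.
Qed.

Lemma l2normN n (v : 'cV[C]_n) : l2norm (- v) = l2norm v.
Proof. by congr Num.sqrt; apply: eq_bigr => i _; rewrite mxE normcN. Qed.

Lemma l2normD n (u v : 'cV[C]_n) : l2norm (u + v) <= l2norm u + l2norm v.
Proof.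
rewrite -(@ler_pXn2r _ 2) ?nnegrE ?addr_ge0 ?l2norm_ge0 //.
rewrite sqrrD !l2norm_sqr.
apply: (@le_trans _ _ (\sum_i (normc (u i 0) ^+ 2 + 2 * (normc (u i 0) * normc (v i 0))
    + normc (v i 0) ^+ 2))).
  apply: ler_sum => i _; rewrite mxE.
  apply: (@le_trans _ _ ((normc (u i 0) + normc (v i 0)) ^+ 2)).
    by rewrite ler_pXn2r ?nnegrE ?addr_ge0 ?normc_ge0 ?normcD_le.
  by rewrite sqrrD -mulr_natl.
rewrite !big_split /= -mulr_sumr -mulr_natl lerD2r lerD2l.
rewrite mulr1 -[leRHS]mulr_natl.
by apply: ler_wpM2l => //; apply: sum_mul_le => i; exact: normc_ge0.
Qed.

Lemma l2norm_isometry m n (A : 'M[C]_(m, n)) (v : 'cV[C]_n) :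
  A ^t* *m A = 1%:M -> l2norm (A *m v) = l2norm v.
Proof.
move=> hA; apply/eqP; rewrite -(@eqrXn2 _ 2) ?l2norm_ge0 //; apply/eqP.
apply: (@complexI R); rewrite !l2norm_dot adjM -mulmxA (mulmxA (A ^t*)) hA.
by rewrite mul1mx.
Qed.

(** With x the norm on the left, x^2 is the inner product of v with the image under [A] of a vector
    of norm x; Cauchy-Schwarz gives x^2 <= x |v|. *)
Lemma l2norm_coisometry m n (A : 'M[C]_(m, n)) (v : 'cV[C]_m) :
  A ^t* *m A = 1%:M -> l2norm (A ^t* *m v) <= l2norm v.
Proof.
move=> hA; set x := l2norm (A ^t* *m v).
have h : x ^+ 2 <= x * l2norm v.
  apply: (@le_trans _ _ (normc (((A *m (A ^t* *m v)) ^t* *m v) 0 0))).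
    by apply: le_real_normc; rewrite l2norm_dot !adjM adjK !mulmxA.
  by apply: le_trans (dot_le _ _) _; rewrite l2norm_isometry.
have : 0 <= x by exact: l2norm_ge0.
rewrite le_eqVlt => /orP[/eqP <-|x0]; first exact: l2norm_ge0.
by rewrite -(ler_pM2l x0) -expr2.
Qed.

Lemma exists_kernel_vector (F : fieldType) p n (A : 'M[F]_(p, n)) : (p < n)%N ->
  exists2 c : 'cV[F]_n, c != 0 & A *m c = 0.
Proof.
move=> pn; have : kermx A^T != 0.
  rewrite -mxrank_eq0 mxrank_ker mxrank_tr subn_eq0 -ltnNge.
  exact: leq_ltn_trans (rank_leq_row A) pn.
move/rowV0Pn => [v /sub_kermxP vA v0]; exists v^T.
  by rewrite -[0]trmx0 (inj_eq trmx_inj).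
by apply: trmx_inj; rewrite trmx_mul trmxK vA trmx0.
Qed.

Lemma gram_unit m n (A : 'M[C]_(m, n)) (a : R) : 0 < a ->
  (forall v : 'cV[C]_n, a * l2norm v <= l2norm (A *m v)) -> A ^t* *m A \in unitmx.
Proof.
move=> a0 hA; rewrite -unitmx_tr -row_free_unit -kermx_eq0.
apply/negPn/negP => /rowV0Pn[v /sub_kermxP vA v0].
have {}vA : (A ^t* *m A) *m v^T = 0.
  by apply: trmx_inj; rewrite trmx_mul trmxK vA trmx0.
have : a * l2norm (v^T) <= 0.
  apply: le_trans (hA _) _; rewrite (_ : l2norm _ = 0) //.
  apply/eqP; rewrite -sqrf_eq0; apply/eqP; apply: (@complexI R).
  by rewrite l2norm_dot adjM -mulmxA (mulmxA (A ^t*)) vA mulmx0 mxE.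
rewrite pmulr_rle0 // => h; move/negP: v0; apply.
have /eqP : l2norm v^T == 0 by rewrite eq_le h l2norm_ge0.
by move/l2norm_eq0 => /(congr1 trmx); rewrite trmxK trmx0 => ->.
Qed.

Lemma frobenius_le m n (A : 'M[C]_(m, n)) (v : 'cV[C]_n) :
  l2norm (A *m v) ^+ 2 <= (\sum_i \sum_j normc (A i j) ^+ 2) * l2norm v ^+ 2.
Proof.
rewrite [X in X <= _]l2norm_sqr mulr_suml; apply: ler_sum => i _.
rewrite l2norm_sqr mxE; apply: (@le_trans _ _ ((\sum_j normc (A i j) * normc (v j 0)) ^+ 2)).
  rewrite ler_pXn2r ?nnegrE ?normc_ge0 //; last first.
    by apply: sumr_ge0 => j _; rewrite mulr_ge0 ?normc_ge0.
  apply: le_trans (normc_sum_le _ _ _) _.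
  by apply: ler_sum => j _; rewrite normcM.
exact: sum_mul_sqr_le.
Qed.

Lemma frobenius_unit_ball m n (A : 'M[C]_(m, n)) (v : 'cV[C]_n) : l2norm v <= 1 ->
  l2norm (A *m v) <= Num.sqrt (\sum_i \sum_j normc (A i j) ^+ 2).
Proof.
move=> v1; have F0 : 0 <= \sum_i \sum_j normc (A i j) ^+ 2.
  by do 2!apply: sumr_ge0 => ? _; exact: sqr_ge0.
rewrite -(@ler_pXn2r _ 2) ?nnegrE ?l2norm_ge0 ?sqrtr_ge0 // [leRHS]sqr_sqrtr //.
apply: le_trans (frobenius_le _ _) _; rewrite -[leRHS]mulr1; apply: ler_wpM2l => //.
by apply: exprn_ile1; rewrite ?l2norm_ge0.
Qed.

(** Makes the supremum in [spectral_norm] a genuine one rather than a default value. *)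
Lemma spectral_norm_ub m n (A : 'M[C]_(m, n)) :
  has_ubound [set l2norm (A *m v) | v in [set v | l2norm v <= 1]]%classic.
Proof.
exists (Num.sqrt (\sum_i \sum_j normc (A i j) ^+ 2)) => _ [v v1 <-].
exact: frobenius_unit_ball.
Qed.

Lemma spectral_norm_ge0 m n (A : 'M[C]_(m, n)) : 0 <= spectral_norm A.
Proof.
apply: (ub_le_sup (spectral_norm_ub A)); exists 0; first by rewrite /= l2norm0.
by rewrite mulmx0 l2norm0.
Qed.

Lemma spectral_norm_bound m n (A : 'M[C]_(m, n)) v :
  l2norm (A *m v) <= spectral_norm A * l2norm v.
Proof.
have [->|v0] := eqVneq v 0; first by rewrite mulmx0 !l2norm0 mulr0.
have n0 := l2norm_gt0 v0.
rewrite -ler_pdivrMr //; apply: (ub_le_sup (spectral_norm_ub A)).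
exists ((((l2norm v)^-1)%:C)%C *: v) => /=.
  by rewrite l2normZ ger0_norm ?invr_ge0 ?l2norm_ge0 // mulVf // gt_eqF.
by rewrite -scalemxAr l2normZ ger0_norm ?invr_ge0 ?l2norm_ge0 // mulrC.
Qed.

Lemma spectral_norm_le_frobenius m n (A : 'M[C]_(m, n)) :
  spectral_norm A <= Num.sqrt (\sum_i \sum_j normc (A i j) ^+ 2).
Proof.
apply: ge_sup; first by exists (l2norm (A *m 0)); exists 0; rewrite /= ?l2norm0.
by move=> _ [v v1 <-]; exact: frobenius_unit_ball.
Qed.

End EuclideanNorm.

(** * Perturbation of the noise space *)

Section NoiseSpacePerturbation.
Variables (R : realType) (S l : nat).
Local Notation C := R[i].
Local Notation m := l.+1.
(** [H0] is the clean matrix, factored through dimension S, and [E] is the noise. The constants a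
    and b bound the smallest singular values of [F] and of the adjoint of [G] from below, so a b
    bounds the S-th singular value of [H0]. *)
Variables (H0 E : 'M[C]_m) (F : 'M[C]_(m, S)) (G : 'M[C]_(S, m)) (a b e : R).
Hypotheses (S0 : (0 < S)%N) (Sl : (S <= l)%N) (a0 : 0 < a) (b0 : 0 < b).
Hypothesis H0E : H0 = F *m G.
Hypothesis hF : forall v : 'cV[C]_S, a * l2norm v <= l2norm (F *m v).
Hypothesis hG : forall v : 'cV[C]_S, b * l2norm v <= l2norm (G ^t* *m v).
Hypothesis hE : forall w : 'cV[C]_m, l2norm (E *m w) <= e * l2norm w.
Hypotheses (e0 : 0 <= e) (he : 2 * e < a * b).
Variables (U V : 'M[C]_m) (s : nat -> R).
Hypothesis hsvd : is_svd (H0 + E) U s V.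
Variables (k : nat) (W : 'M[C]_(m, k)).
Hypothesis hW : orthonormal_basis_range_perp H0 W.

Let Sg : 'M[C]_m := \matrix_(i < m, j < m) (if i == j :> nat then (s i)%:C%C else 0).

Let s_ge0 i : 0 <= s i. Proof. by case: hsvd. Qed.
Let s_le i j : (i <= j)%N -> s j <= s i. Proof. by case: hsvd => _ _ _ h _; exact: h. Qed.
Let HE : H0 + E = U *m Sg *m V ^t*. Proof. by case: hsvd. Qed.

Let UU : U ^t* *m U = 1%:M.
Proof. by case: hsvd => /unitarymxP/mulmx1C. Qed.
Let UU' : U *m U ^t* = 1%:M.
Proof. by case: hsvd => /unitarymxP. Qed.
Let VV : V ^t* *m V = 1%:M.
Proof. by case: hsvd => _ /unitarymxP/mulmx1C. Qed.
Let VV' : V *m V ^t* = 1%:M.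
Proof. by case: hsvd => _ /unitarymxP. Qed.

Let normU' (v : 'cV[C]_m) : l2norm (U ^t* *m v) = l2norm v.
Proof. by apply: l2norm_isometry; rewrite adjK. Qed.
Let normV' (v : 'cV[C]_m) : l2norm (V ^t* *m v) = l2norm v.
Proof. by apply: l2norm_isometry; rewrite adjK. Qed.

Let SgE (c : 'cV[C]_m) i : (Sg *m c) i 0 = (s i)%:C%C * c i 0.
Proof.
rewrite mxE (bigD1 i) //= mxE eqxx big1 ?addr0 // => j ji.
by rewrite mxE eq_sym val_eqE (negbTE ji) mul0r.
Qed.

Let normSgE (c : 'cV[C]_m) i :
  normc ((Sg *m c) i 0) ^+ 2 = s i ^+ 2 * normc (c i 0) ^+ 2.
Proof. by rewrite SgE normcM normc_real exprMn ger0_norm. Qed.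

Lemma singular_values_ge (c : 'cV[C]_m) (p : nat) :
  (forall i : 'I_m, (p < i)%N -> c i 0 = 0) -> s p * l2norm c <= l2norm (Sg *m c).
Proof.
move=> hc; rewrite -(@ler_pXn2r _ 2) ?nnegrE ?mulr_ge0 ?l2norm_ge0 //.
rewrite exprMn !l2norm_sqr mulr_sumr; apply: ler_sum => i _.
rewrite normSgE; have [pi|ip] := ltnP p i.
  by rewrite hc // normc0 expr0n !mulr0.
apply: ler_wpM2r; first exact: sqr_ge0.
by apply: lerXn2r; rewrite ?nnegrE ?s_ge0 ?s_le.
Qed.

Lemma singular_values_le (c : 'cV[C]_m) (p : nat) :
  (forall i : 'I_m, (i < p)%N -> c i 0 = 0) -> l2norm (Sg *m c) <= s p * l2norm c.
Proof.
move=> hc; rewrite -(@ler_pXn2r _ 2) ?nnegrE ?mulr_ge0 ?l2norm_ge0 //.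
rewrite exprMn !l2norm_sqr mulr_sumr; apply: ler_sum => i _.
rewrite normSgE; have [ip|pi] := ltnP i p.
  by rewrite hc // normc0 expr0n !mulr0.
apply: ler_wpM2r; first exact: sqr_ge0.
by apply: lerXn2r; rewrite ?nnegrE ?s_ge0 ?s_le.
Qed.

Let HV (c : 'cV[C]_m) : (H0 + E) *m (V *m c) = U *m (Sg *m c).
Proof. by rewrite HE -!mulmxA (mulmxA (V ^t*)) VV mul1mx. Qed.

Let normHV (w : 'cV[C]_m) : l2norm ((H0 + E) *m w) = l2norm (Sg *m (V ^t* *m w)).
Proof. by rewrite HE -!mulmxA l2norm_isometry. Qed.

(** Indices start at 0, so [s S] is the (S + 1)-st singular value. Some nonzero vector in the span
    of the first S + 1 right singular vectors is killed by [G]; there [H0 + E] acts as [E]. *)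
Lemma weyl_upper : s S <= e.
Proof.
(* [T] reads off the coordinates beyond S; with the S rows of [G *m V] this makes l conditions in
   dimension l + 1. *)
pose T : 'M[C]_(l - S, m) := \matrix_(i, j) (j == (S.+1 + i)%N :> nat)%:R.
have dim : (S + (l - S) < m)%N by rewrite subnKC.
have [c c0] := exists_kernel_vector (col_mx (G *m V) T) dim.
rewrite mul_col_mx => /eqP; rewrite col_mx_eq0 => /andP[/eqP GVc /eqP Tc].
have supp (i : 'I_m) : (S < i)%N -> c i 0 = 0.
  move=> Si; have hi : (i - S.+1 < l - S)%N by have := ltn_ord i; lia.
  have := congr1 (fun M : 'cV[C]_(l - S) => M (Ordinal hi) 0) Tc.
  rewrite mxE (bigD1 i) //= !mxE subnKC // eqxx mul1r big1 ?addr0 // => j ji.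
  by rewrite mxE /= subnKC // val_eqE (negbTE ji) mul0r.
have cn := l2norm_gt0 c0.
rewrite -(ler_pM2r cn); apply: le_trans (singular_values_ge supp) _.
rewrite -(l2norm_isometry (Sg *m c) UU) -HV mulmxDl H0E -mulmxA (mulmxA G) GVc.
by rewrite mulmx0 add0r; apply: le_trans (hE _) _; rewrite l2norm_isometry.
Qed.

(** With w the image of c, |w|^2 is the inner product of c and G w, while b |c| <= |w|. *)
Lemma range_factor_norm (c : 'cV[C]_S) :
  b * l2norm (G ^t* *m c) <= l2norm (G *m (G ^t* *m c)).
Proof.
set w := G ^t* *m c.
have [w0|wn0] := eqVneq (l2norm w) 0; first by rewrite w0 mulr0 l2norm_ge0.
have wp : 0 < l2norm w by rewrite lt_def wn0 l2norm_ge0.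
have h : l2norm w ^+ 2 <= l2norm c * l2norm (G *m w).
  apply: le_trans (dot_le _ _); apply: le_real_normc.
  by rewrite l2norm_dot {1}/w adjM adjK -mulmxA.
rewrite -(ler_pM2l wp) mulrCA -expr2.
apply: (@le_trans _ _ (b * (l2norm c * l2norm (G *m w)))).
  by apply: ler_wpM2l => //; exact: ltW.
by rewrite mulrA; apply: ler_wpM2r; [exact: l2norm_ge0|exact: hG].
Qed.

Lemma signal_norm (c : 'cV[C]_S) :
  a * b * l2norm (G ^t* *m c) <= l2norm (H0 *m (G ^t* *m c)).
Proof.
rewrite H0E -mulmxA -mulrA; apply: le_trans (hF _).
by apply: ler_wpM2l; [exact: ltW|exact: range_factor_norm].
Qed.

(** The preimage is taken in the range of the adjoint of [G], where [signal_norm] applies. *)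
Lemma signal_preimage (d : 'cV[C]_S) :
  exists2 w : 'cV[C]_m, H0 *m w = F *m d & a * b * l2norm w <= l2norm (F *m d).
Proof.
have gu : G *m G ^t* \in unitmx.
  by have := gram_unit b0 hG; rewrite adjK.
have e1 : H0 *m (G ^t* *m (invmx (G *m G ^t*) *m d)) = F *m d.
  by rewrite H0E -!mulmxA (mulmxA G) (mulmxA (G *m G ^t*)) mulmxV // mul1mx.
by exists (G ^t* *m (invmx (G *m G ^t*) *m d)); rewrite // -e1; exact: signal_norm.
Qed.

(** The range of the adjoint of [G] has dimension S, so it contains a nonzero w orthogonal to the
    first S - 1 right singular vectors. For it, |(H0 + E) w| <= s_(S-1) |w| and |H0 w| >= a b
    |w|. *)
Lemma weyl_lower : a * b - e <= s S.-1.
Proof.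
pose T : 'M[C]_(S.-1, S) := \matrix_(i, j) (V ^t* *m G ^t*) (inord i) j.
have dim : (S.-1 < S)%N by rewrite prednK.
have [c c0 Tc] := exists_kernel_vector T dim.
set w := G ^t* *m c.
have wn : 0 < l2norm w.
  by apply: lt_le_trans (hG c); rewrite mulr_gt0 // l2norm_gt0.
have supp (i : 'I_m) : (i < S.-1)%N -> (V ^t* *m w) i 0 = 0.
  move=> iS; have h : (T *m c) (Ordinal iS) 0 = 0 by rewrite Tc mxE.
  rewrite -[RHS]h /w mulmxA [LHS]mxE [RHS]mxE; apply: eq_bigr => j _.
  by rewrite [T _ _]mxE /= inord_val.
rewrite lerBlDr -(ler_pM2r wn); apply: le_trans (signal_norm c) _.
rewrite -/w (_ : H0 = (H0 + E) - E); last by rewrite addrK.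
rewrite mulmxBl; apply: le_trans (l2normD _ _) _; rewrite l2normN mulrDl.
apply: lerD; last exact: hE.
by rewrite normHV -(normV' w); exact: singular_values_le.
Qed.

Lemma last_columns_sqr (v : 'cV[C]_m) :
  l2norm ((last_columns S U) ^t* *m v) ^+ 2 =
  \sum_(i < m | (S <= i)%N) normc ((U ^t* *m v) i 0) ^+ 2.
Proof.
have Sm : (S <= m)%N by exact: leqW.
pose f i := normc ((U ^t* *m v) (inord i) 0) ^+ 2.
rewrite l2norm_sqr; transitivity (\sum_(i < m - S) f (i + S)%N).
  apply: eq_bigr => i _; rewrite /f; congr (normc _ ^+ 2).
  by rewrite !mxE; apply: eq_bigr => j _; rewrite !mxE addnC.
transitivity (\sum_(i < m | (S <= i)%N) f i); last first.
  by apply: eq_bigr => i _; rewrite /f inord_val.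
rewrite -(big_mkord (fun i => (S <= i)%N) f) (big_cat_nat (n := S)) //=.
rewrite big_nat_cond [X in _ = X + _]big_pred0 ?add0r; last first.
  by move=> i; case: ltnP; rewrite ?andbF.
rewrite (@big_addn _ _ _ 0 m S) big_mkord; apply: eq_bigl => i.
by rewrite leq_addl.
Qed.

Lemma last_columns_le (v : 'cV[C]_m) :
  l2norm ((last_columns S U) ^t* *m v) <= l2norm v.
Proof.
apply: l2norm_le; rewrite last_columns_sqr -(normU' v) l2norm_sqr.
rewrite [leRHS](bigID (fun i : 'I_m => (S <= i)%N)) /= lerDl.
by apply: sumr_ge0 => i _; exact: sqr_ge0.
Qed.

Lemma last_columns_data (w : 'cV[C]_m) :
  l2norm ((last_columns S U) ^t* *m ((H0 + E) *m w)) <= s S * l2norm w.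
Proof.
rewrite -(@ler_pXn2r _ 2) ?nnegrE ?mulr_ge0 ?l2norm_ge0 // last_columns_sqr.
rewrite HE -!mulmxA (mulmxA (U ^t*)) UU mul1mx -(normV' w) exprMn !l2norm_sqr.
rewrite mulr_sumr [leRHS](bigID (fun i : 'I_m => (S <= i)%N)) /=.
apply: le_trans (_ : \sum_(i < m | (S <= i)%N) s S ^+ 2 *
    normc ((V ^t* *m w) i 0) ^+ 2 <= _); last first.
  by rewrite lerDl; apply: sumr_ge0 => i _; rewrite mulr_ge0 ?sqr_ge0.
apply: ler_sum => i Si; rewrite normSgE; apply: ler_wpM2r; first exact: sqr_ge0.
by apply: lerXn2r; rewrite ?nnegrE ?s_ge0 ?s_le.
Qed.

Let WW : W ^t* *m W = 1%:M. Proof. by case: hW. Qed.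

Lemma noise_annihilates (u : 'cV[C]_m) : W ^t* *m (H0 *m u) = 0.
Proof.
apply: l2norm_eq0; apply/eqP; rewrite -sqrf_eq0; apply/eqP.
apply: (@complexI R); rewrite l2norm_dot.
have h : (H0 *m u) ^t* *m (W *m (W ^t* *m (H0 *m u))) = 0.
  by case: hW => _ /(_ (W *m (W ^t* *m (H0 *m u))))[_]; apply; eexists.
by rewrite adjM adjK -mulmxA h mxE.
Qed.

(** [F *m d] is the orthogonal projection of phi on the range of [F]. The residue is orthogonal to
    the range of [H0], hence in the range of [W]; and [W ^t*] kills [F *m d], which equals some
    [H0 *m w]. *)
Lemma noise_projection (phi : 'cV[C]_m) : exists d c,
  [/\ phi = F *m d + W *m c, l2norm (F *m d) <= l2norm phi &
      l2norm (W *m c) = l2norm (W ^t* *m phi)].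
Proof.
have fu : F ^t* *m F \in unitmx by exact: gram_unit a0 hF.
pose d := invmx (F ^t* *m F) *m (F ^t* *m phi).
have Fn : F ^t* *m (phi - F *m d) = 0.
  by rewrite mulmxBr mulmxA /d mulmxA mulmxV // mul1mx subrr.
have [c hc] : exists c, phi - F *m d = W *m c.
  apply/(proj2 hW) => u.
  by rewrite H0E -mulmxA adjM -mulmxA Fn mulmx0.
exists d, c; split.
- by rewrite -hc addrC subrK.
- have h : l2norm (F *m d) ^+ 2 <= l2norm (F *m d) * l2norm phi.
    apply: le_trans (dot_le _ _); apply: le_real_normc; rewrite l2norm_dot.
    apply/eqP; rewrite -subr_eq0 -oppr_eq0 opprB; apply/eqP.
    transitivity (((F *m d) ^t* *m (phi - F *m d)) 0 0).
      by rewrite mulmxBr !mxE.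
    by rewrite adjM -mulmxA Fn mulmx0 mxE.
  have : 0 <= l2norm (F *m d) by exact: l2norm_ge0.
  rewrite le_eqVlt => /orP[/eqP <-|x0]; first exact: l2norm_ge0.
  by rewrite -(ler_pM2l x0) -expr2.
- have [w hw _] := signal_preimage d.
  rewrite -[phi](subrK (F *m d)) hc mulmxDr -hw noise_annihilates addr0 mulmxA WW.
  by rewrite mul1mx l2norm_isometry.
Qed.

Theorem noise_correlation_perturbation (phi : 'cV[C]_m) :
  `|l2norm ((last_columns S U) ^t* *m phi) - l2norm (W ^t* *m phi)|
    <= 2 * e / (a * b) * l2norm phi.
Proof.
have ab0 : 0 < a * b by rewrite mulr_gt0.
have phi0 := l2norm_ge0 phi.
rewrite ler_norml; apply/andP; split.
- (* W ^* phi through the leading left singular vectors of H0 + E *)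
  pose y := U ^t* *m phi.
  (* [c1] and [c3] split the coordinates of phi at index S; [c2] makes [V *m c2] a preimage of
     [U *m c1] under [H0 + E]. *)
  pose c1 : 'cV[C]_m := \col_i (if (i < S)%N then y i 0 else 0).
  pose c2 : 'cV[C]_m := \col_i (if (i < S)%N then y i 0 / (s i)%:C%C else 0).
  pose c3 : 'cV[C]_m := \col_i (if (S <= i)%N then y i 0 else 0).
  have sp : 0 < s S.-1 by have := weyl_lower; have := he; have := e0; lra.
  have yE : y = c1 + c3.
    apply/colP => i; rewrite !mxE; case: ltnP => _; first by rewrite addr0.
    by rewrite add0r.
  have Sc2 : Sg *m c2 = c1.
    apply/colP => i; rewrite SgE !mxE; case: ltnP => iS; last by rewrite mulr0.
    rewrite mulrCA divff ?mulr1 //; apply/eqP => -[] /eqP; rewrite gt_eqF //.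
    by apply: lt_le_trans sp _; apply: s_le; rewrite -ltnS prednK.
  have phiE : phi = (H0 + E) *m (V *m c2) + U *m c3.
    by rewrite HV Sc2 -mulmxDr -yE mulmxA UU' mul1mx.
  have n3 : l2norm (U *m c3) = l2norm ((last_columns S U) ^t* *m phi).
    rewrite l2norm_isometry //; apply/eqP.
    rewrite -(@eqrXn2 _ 2) ?l2norm_ge0 //; apply/eqP.
    rewrite last_columns_sqr l2norm_sqr [RHS]big_mkcond /=.
    by apply: eq_bigr => i _; rewrite mxE; case: ifP => // _; rewrite normc0 expr0n.
  have n2 : s S.-1 * l2norm c2 <= l2norm phi.
    apply: (@le_trans _ _ (l2norm c1)).
      rewrite -Sc2; apply: singular_values_ge => i Si.
      by rewrite mxE ifN // -leqNgt -ltnS -(prednK S0) ltnS.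
    rewrite -(normU' phi) -/y; apply: l2norm_le; rewrite !l2norm_sqr.
    apply: ler_sum => i _; rewrite mxE; case: ifP => // _.
    by rewrite normc0 expr0n sqr_ge0.
  have h : l2norm (W ^t* *m phi) <= e * l2norm c2 + l2norm ((last_columns S U) ^t* *m phi).
    rewrite [X in l2norm (W ^t* *m X)]phiE mulmxDr mulmxDl mulmxDr noise_annihilates.
    rewrite add0r; apply: le_trans (l2normD _ _) _; apply: lerD.
      apply: le_trans (l2norm_coisometry _ WW) _.
      by apply: le_trans (hE _) _; rewrite l2norm_isometry.
    by rewrite -n3; exact: l2norm_coisometry.
  suff : e * l2norm c2 <= 2 * e / (a * b) * l2norm phi by lra.
  (* The S-th singular value is at least a b - e, hence at least a b / 2. *)
  have h2 : a * b / 2 * l2norm c2 <= l2norm phi.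
    apply: le_trans n2; apply: ler_wpM2r; first exact: l2norm_ge0.
    by have := weyl_lower; have := he; lra.
  rewrite (_ : 2 * e / _ * _ = e * (2 * l2norm phi / (a * b))); last by ring.
  apply: ler_wpM2l => //; rewrite ler_pdivlMr //.
  by move: h2; rewrite mulrAC ler_pdivrMr // [_ * (a * b)]mulrC [_ * 2]mulrC.
(* Conversely, the signal part of phi is H0 w = (H0 + E) w - E w, and the last left singular vectors
   see at most e |w| of each term, by [weyl_upper] for the first. *)
- have [d [c [phiE n1 n2]]] := noise_projection phi.
  have [w hw wn] := signal_preimage d.
  have h : l2norm ((last_columns S U) ^t* *m phi) <=
      l2norm (W ^t* *m phi) + 2 * e * l2norm w.
    rewrite [X in l2norm (_ *m X) <= _]phiE addrC mulmxDr.
    apply: le_trans (l2normD _ _) _; apply: lerD.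
      by rewrite -n2; exact: last_columns_le.
    rewrite -hw (_ : H0 *m w = (H0 + E) *m w - E *m w); last by rewrite mulmxDl addrK.
    rewrite mulmxBr; apply: le_trans (l2normD _ _) _; rewrite l2normN.
    apply: le_trans (lerD (last_columns_data w) (last_columns_le _)) _.
    apply: le_trans (lerD (ler_wpM2r (l2norm_ge0 w) weyl_upper) (hE w)) _.
    by rewrite -mulrDl -mulr2n -[e *+ 2]mulr_natl.
  suff : 2 * e * l2norm w <= 2 * e / (a * b) * l2norm phi by lra.
  rewrite -!mulrA; do 2!apply: ler_wpM2l => //.
  by rewrite mulrC ler_pdivlMr // mulrC; exact: le_trans n1.
Qed.

End NoiseSpacePerturbation.

(** * Hankel matrices *)

(** For M = 2 L the Hankel matrix is square, but [(M - L).+1] and [L.+1] agree only propositionally;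
    this form carries the square result over. *)
Lemma noise_correlation_perturbation_wide (R : realType) (S l n : nat)
    (H0 E : 'M[R[i]]_(l.+1, n.+1)) (F : 'M[R[i]]_(l.+1, S)) (G : 'M[R[i]]_(S, n.+1))
    (a b e : R) (U : 'M[R[i]]_l.+1) (s : nat -> R) (V : 'M[R[i]]_n.+1)
    (k : nat) (W : 'M[R[i]]_(l.+1, k)) (phi : 'cV[R[i]]_l.+1) :
  n = l -> (0 < S)%N -> (S <= l)%N -> 0 < a -> 0 < b -> H0 = F *m G ->
  (forall v : 'cV_S, a * l2norm v <= l2norm (F *m v)) ->
  (forall v : 'cV_S, b * l2norm v <= l2norm (G ^t* *m v)) ->
  (forall w : 'cV_(n.+1), l2norm (E *m w) <= e * l2norm w) ->
  0 <= e -> 2 * e < a * b -> is_svd (H0 + E) U s V ->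
  orthonormal_basis_range_perp H0 W ->
  `|l2norm ((last_columns S U) ^t* *m phi) - l2norm (W ^t* *m phi)|
    <= 2 * e / (a * b) * l2norm phi.
Proof.
move=> nl; subst n => S0 Sl a0 b0 H0E hF hG hE e0 he hsvd hW.
exact: (noise_correlation_perturbation S0 Sl a0 b0 H0E hF hG hE e0 he hsvd hW).
Qed.

Section Hankel.
Variables (R : realType) (M L : nat).
Hypothesis LM : (L <= M)%N.

Let inordpq (p : 'I_L.+1) (q : 'I_(M - L).+1) : (inord (p + q) : 'I_M.+1) = (p + q)%N :> nat.
Proof. by rewrite inordK //; have := ltn_ord p; have := ltn_ord q; lia. Qed.

Lemma hankelD (y z : 'cV[R[i]]_M.+1) : hankel L (y + z) = hankel L y + hankel L z.
Proof. by apply/matrixP => p q; rewrite !mxE. Qed.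

(** This is diag(x) times the transposed Fourier matrix with M - L + 1 rows. *)
Definition vandermonde_factor (S : nat) (omega : 'I_S -> R) (x : 'cV[R[i]]_S) :
    'M[R[i]]_(S, (M - L).+1) :=
  \matrix_(j, q) (x j 0 * circle (omega j) ^+ q).

Lemma hankel_factorization S (omega : 'I_S -> R) (x : 'cV[R[i]]_S) :
  hankel L (Phi M omega *m x) = Phi L omega *m vandermonde_factor omega x.
Proof.
apply/matrixP => p q; rewrite !mxE; apply: eq_bigr => j _.
by rewrite !mxE inordpq !expi_circle exprD; ring.
Qed.

(** Each of the L + 1 rows is a window of z, which bounds the Frobenius norm. *)
Lemma hankel_spectral_norm (z : 'cV[R[i]]_M.+1) :
  spectral_norm (hankel L z) <= Num.sqrt L.+1%:R * l2norm z.
Proof.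
apply: le_trans (spectral_norm_le_frobenius _) _.
rewrite -sqrtrM ?ler0n //; apply: ler_wsqrtr.
rewrite -[in leRHS](card_ord L.+1) mulr_natl -sumr_const; apply: ler_sum => p _.
apply: (@le_trans _ _ (\sum_(q < (M - L).+1) normc (z (inord (p + q)) 0) ^+ 2)).
  by apply: ler_sum => q _; rewrite mxE.
apply: le_trans (sum_shift_le (a := fun m => normc (z (inord m) 0) ^+ 2) (K := M.+1) _ _) _.
- by move=> m; exact: sqr_ge0.
- by have := ltn_ord p; lia.
- by apply: ler_sum => m _; rewrite inord_val.
Qed.

End Hankel.

(** * Explicit constants and the final estimate *)

Lemma phi_neq0 (R : realType) L (w : R) : phi L w != 0.
Proof.
apply/eqP => /matrixP/(_ ord0 0); rewrite !mxE => /(congr1 (@normc R)).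
by rewrite normc_expi normc0 => /eqP; rewrite oner_eq0.
Qed.

Lemma min_modulus_le (R : realType) n (x : 'cV[R[i]]_n) j : min_modulus x <= normc (x j 0).
Proof.
apply: ge_inf; last by exists j.
by exists 0 => _ [i _ <-]; exact: normc_ge0.
Qed.

(** Amounts to sqrt(L) <= sqrt(L + 1); it trades the L + 1 of the singular value bound for the L of
    the final estimate. *)
Lemma sqrt_succ_bound (R : realType) (L : nat) : (0 < L)%N ->
  Num.sqrt L.+1%:R * L%:R <= Num.sqrt L%:R * L.+1%:R :> R.
Proof.
move=> L0; rewrite -[X in _ * X <= _]sqr_sqrtr // -[X in _ <= _ * X]sqr_sqrtr //.
rewrite -subr_ge0.
rewrite (_ : _ - _ = Num.sqrt L%:R * Num.sqrt L.+1%:R *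
  (Num.sqrt L.+1%:R - Num.sqrt L%:R)); last by ring.
by rewrite mulr_ge0 ?mulr_ge0 ?sqrtr_ge0 // subr_ge0 ler_wsqrtr // ler_nat.
Qed.

Theorem corollary4p5 (R : realType) (A M S L : nat)
    (hA : (0 < A)%N) (hM : (0 < M)%N) (hS : (0 < S)%N)
    (hMS : (S ^ 2 <= M)%N) (hMeven : ~~ odd M) (hL : L = M./2)
    (alpha beta : R) (halpha : 0 < alpha) (hbeta : 0 < beta)
    (omega : 'I_S -> R) (Lambda : 'I_A -> {set 'I_S})
    (hclumps : clumps_model L beta alpha omega Lambda)
    (hbeta_ge : forall a : 'I_A,
       20 * powR S%:R (1 / 2) * powR #|Lambda a|%:R (5 / 2) / powR alpha (1 / 2)
         <= beta)
    (x : 'cV[R[i]]_S) (eta : 'cV[R[i]]_M.+1)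
    (hnoise :
       4 * spectral_norm (hankel L eta)
         * (\sum_(a < A) (C_const R #|Lambda a| L * alpha ^- (#|Lambda a| - 1)) ^+ 2)
       < min_modulus x * M%:R)
    (k : nat) (W : 'M[R[i]]_(L.+1, k))
    (hW : orthonormal_basis_range_perp (hankel L (Phi M omega *m x)) W)
    (U : 'M[R[i]]_L.+1) (s : nat -> R) (V : 'M[R[i]]_((M - L).+1))
    (hsvd : is_svd (hankel L (Phi M omega *m x + eta)) U s V) :
  (ereal_sup [set (`|noise_correlation (last_columns S U) w
                     - noise_correlation W w|)%:E
             | w in [set w : R | (0 <= w < 1)%R]]%classic
   <= (4 * Num.sqrt L%:R * l2norm eta / (min_modulus x * M%:R)
       * \sum_(a < A) (C_const R #|Lambda a| L * alpha ^- (#|Lambda a| - 1)) ^+ 2)%:E)%E.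
Proof.
have M2L : M = (L + L)%N by rewrite hL addnn even_halfK.
have L0 : (0 < L)%N by lia.
have SL : (S <= L)%N by move: hMS; rewrite M2L; nia.
have LM : (L <= M)%N by rewrite M2L leq_addr.
have nL : (M - L = L)%N by rewrite M2L addnK.
set Sg := \sum_(a < A) _ in hnoise *; set e := spectral_norm _ in hnoise.
set xm := min_modulus x in hnoise *.
have bound v : L.+1%:R * (\sum_j normc (v j) ^+ 2) <= Sg *
    \sum_(m < L.+1) normc (\sum_k circle (omega k) ^+ m * v k) ^+ 2.
  exact: vandermonde_clumps_lower_bound hbeta_ge.
have LR : 0 < L%:R :> R by rewrite ltr0n.
have L1R : 0 < L.+1%:R :> R by rewrite ltr0n.
have MR : M%:R = 2 * L%:R :> R by rewrite M2L natrD; ring.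
have e0 : 0 <= e by exact: spectral_norm_ge0.
have Sg_ge0 : 0 <= Sg by apply: sumr_ge0 => a _; exact: sqr_ge0.
(* A vanishing sum would give (L + 1) S <= 0 in [bound] at the vector of ones. *)
have Sg0 : 0 < Sg.
  rewrite lt_def Sg_ge0 andbT; apply/eqP => Sg0.
  have := bound (fun=> 1); rewrite Sg0 mul0r.
  under eq_bigr do rewrite normc1 expr1n.
  by rewrite sumr_const card_ord -natrM pmulrn lern0 muln_eq0 /= => /eqP; lia.
(* Strictness in the noise hypothesis forces all amplitudes to be nonzero. *)
have xm0 : 0 < xm.
  have : 0 < xm * M%:R by apply: le_lt_trans hnoise; rewrite !mulr_ge0.
  by rewrite pmulr_lgt0 // ltr0n.
pose a := Num.sqrt (L.+1%:R / Sg).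
have a0 : 0 < a by rewrite sqrtr_gt0 divr_gt0.
have a2 : a ^+ 2 = L.+1%:R / Sg by rewrite sqr_sqrtr // divr_ge0 // ltW.
have boundN n v : n = L -> a ^+ 2 * (\sum_j normc (v j) ^+ 2) <=
    \sum_(m < n.+1) normc (\sum_k circle (omega k) ^+ m * v k) ^+ 2.
  by move=> ->; rewrite a2 mulrAC ler_pdivrMr // mulrC [leRHS]mulrC mulrC; exact: bound.
have hF (v : 'cV_S) : a * l2norm v <= l2norm (Phi L omega *m v).
  rewrite -(@ler_pXn2r _ 2) ?nnegrE ?mulr_ge0 ?l2norm_ge0 ?(ltW a0) ?(ltW xm0) //.
  rewrite exprMn !l2norm_sqr; apply: le_trans (boundN L (fun j => v j 0) erefl) _.
  apply: ler_sum => m _; rewrite mxE.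
  by under [in leRHS]eq_bigr => j _ do rewrite mxE expi_circle.
have hG (v : 'cV_S) : xm * a * l2norm v <=
    l2norm ((vandermonde_factor M L omega x) ^t* *m v).
  rewrite -(@ler_pXn2r _ 2) ?nnegrE ?mulr_ge0 ?l2norm_ge0 ?(ltW a0) ?(ltW xm0) //.
  rewrite !exprMn !l2norm_sqr mulrAC mulrC.
  (* The adjoint conjugates the nodes, so [boundN] is applied to the vector with entries x_j
     conj(v_j) and the sums are conjugated afterwards. *)
  apply: (@le_trans _ _ (a ^+ 2 * \sum_j normc (x j 0 * (v j 0)^*) ^+ 2)).
    apply: ler_wpM2l; first exact: sqr_ge0.
    rewrite mulr_sumr; apply: ler_sum => j _; rewrite normcM normc_conj exprMn.
    apply: ler_wpM2r; first exact: sqr_ge0.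
    by apply: lerXn2r; rewrite ?nnegrE ?normc_ge0 ?min_modulus_le ?(ltW xm0).
  apply: le_trans (boundN _ _ nL) _; apply: ler_sum => q _.
  rewrite -normc_conj rmorph_sum mxE le_eqVlt; apply/orP; left; apply/eqP.
  congr (normc _ ^+ 2); apply: eq_bigr => j _.
  by rewrite adjE mxE !rmorphM /= conjCK; ring.
have ab : a * (xm * a) = xm * L.+1%:R / Sg by rewrite mulrCA -expr2 a2 mulrA.
(* As M = 2 L, the noise hypothesis reads 2 e Sg < xm L, and xm L is below xm (L + 1). *)
have he : 2 * e < a * (xm * a).
  rewrite ab ltr_pdivlMr //; move: hnoise; rewrite MR -natr1; nra.
apply: ge_ereal_sup => _ [w _ <-]; rewrite lee_fin /noise_correlation.
have n0 := l2norm_gt0 (phi_neq0 L w).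
rewrite -mulrBl normrM [`|_^-1|]gtr0_norm ?invr_gt0 // ler_pdivrMr //.
have := hsvd; rewrite hankelD => hsvd'.
apply: le_trans (noise_correlation_perturbation_wide (phi L w) nL hS SL a0
  (mulr_gt0 xm0 a0) (hankel_factorization LM omega x) hF hG
  (spectral_norm_bound (hankel L eta)) e0 he hsvd' hW) _.
apply: ler_wpM2r; first exact: ltW.
rewrite ab MR -/e.
rewrite (_ : 2 * e / _ = 2 * Sg / xm * (e / L.+1%:R)); last first.
  by field; rewrite !gt_eqF.
rewrite [leRHS](_ : _ = 2 * Sg / xm * (Num.sqrt L%:R * l2norm eta / L%:R)); last first.
  by field; rewrite !gt_eqF.
apply: ler_wpM2l; first by rewrite divr_ge0 ?mulr_ge0 // ltW.
(* What remains is e / (L + 1) <= sqrt(L) |eta| / L, where e <= sqrt(L + 1) |eta|. *)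
rewrite ler_pdivrMr // mulrAC ler_pdivlMr //.
apply: le_trans (ler_wpM2r (ltW LR) (hankel_spectral_norm LM eta)) _.
rewrite mulrAC [leRHS]mulrAC; apply: ler_wpM2r; first exact: l2norm_ge0.
exact: sqrt_succ_bound.
Qed.
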